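(* Let $G=(V,E)$ be a random power law graph on $n$ vertices with average degree $\nu>1$ and exponent $\beta=2+\varepsilon$ with $0<\varepsilon<1/2$. With high probability over the randomness of $G$, every distance labeling scheme for $G$ that recovers all pairwise distances exactly has total length at least $\Omega(n^{3/2-\varepsilon})$. In particular, with high probability every 2-hop cover of $G$ stores at least $\Omega(n^{3/2-\varepsilon})$ landmarks in total.
   Context: Random power law graph: for $x_{\min}>0$, $\beta>2$, let $f(t)=Zt^{-\beta}$ on $[x_{\min},\infty)$, $Z=(\beta-1)x_{\min}^{\beta-1}$, with mean $\nu$ (the average degree). Each vertex gets an independent weight $p_x\sim f$; given weights, each pair of distinct vertices $x,y$ is an edge independently with probability $\min\{p_xp_y/\mathrm{vol}(V),1\}$, $\mathrm{vol}(V)=\sum_xp_x$. A distance labeling scheme assigns to each vertex $v$ a binary string $\mathcal L(v)$ such that a decoding rule fixed in advance (not depending on $G$) computes $\mathrm{dist}_G(x,y)$ from $\mathcal L(x),\mathcal L(y)$ alone; its total length is $\sum_v|\mathcal L(v)|$. A 2-hop cover is a landmark labeling $\{L(v)\}$ (landmarks stored with their distances) with $\min_{z\in L(x)\cap L(y)}(\mathrm{dist}(x,z)+\mathrm{dist}(z,y))=\mathrm{dist}(x,y)$ for all pairs in the same connected component; its number of landmarks is $\sum_v|L(v)|$. ''With high probability'' means with probability tending to $1$ as $n\to\infty$. *)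

(* Defs.v *)
From HB Require Import structures.
From mathcomp Require Import all_boot all_order all_algebra.
From mathcomp Require Import all_classical all_reals all_analysis.
Set Implicit Arguments. Unset Strict Implicit. Unset Printing Implicit Defensive.
Import Order.TTheory GRing.Theory Num.Theory.
Local Open Scope classical_set_scope.
Local Open Scope ring_scope.

(* A graph on 'I_n is given by a set of ordered pairs; only pairs (i,j) with
   i < j are meaningful (the random model gives probability 0 to any other
   set), and (i,j) represents the undirected edge {i,j}. *)
Definition graph (n : nat) := {set ('I_n * 'I_n)}.

Definition adj n (E : graph n) : rel 'I_n :=
  fun x y => ((x, y) \in E) || ((y, x) \in E).

Definition walk_len n (E : graph n) (x y : 'I_n) (k : nat) : bool :=
  [exists p : k.-tuple 'I_n, path (adj E) x p && (last x p == y)].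

(* graph distance; None = infinite (x, y in different components).
   A shortest walk has fewer than n edges, so searching k < n suffices. *)
Definition gdist n (E : graph n) (x y : 'I_n) : option nat :=
  let k := find (walk_len E x y) (iota 0 n) in
  if (k < n)%N then Some k else None.

(* 2-hop cover: L v is the set of landmarks of v (their distances being
   stored alongside).  For every pair x, y in the same connected component,
   min_{z in L x :&: L y} (dist(x,z) + dist(z,y)) = dist(x,y)
   (terms with an infinite distance do not contribute to the min). *)
Definition two_hop_cover n (E : graph n) (L : 'I_n -> {set 'I_n}) : Prop :=
  forall x y : 'I_n, forall d : nat, gdist E x y = Some d ->
    (exists2 z, z \in L x :&: L y &
       exists a b, [/\ gdist E x z = Some a, gdist E z y = Some b & (a + b = d)%N])
    /\ (forall z, z \in L x :&: L y -> forall a b,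
          gdist E x z = Some a -> gdist E z y = Some b -> (d <= a + b)%N).

Section RPL.
Variable R : realType.

Definition plf (xmin beta : R) (t : R) : R :=
  if xmin <= t then ((beta - 1) * xmin `^ (beta - 1)) * t `^ (- beta) else 0.

Definition edge_prob n (w : 'I_n -> R) (i j : 'I_n) : R :=
  Num.min (w i * w j / (\sum_(k < n) w k)) 1.

Definition graph_prob n (w : 'I_n -> R) (E : graph n) : R :=
  if [forall e in E, (nat_of_ord e.1 < nat_of_ord e.2)%N] then
    \prod_(i : 'I_n) \prod_(j : 'I_n | (nat_of_ord i < nat_of_ord j)%N)
       (if (i, j) \in E then edge_prob w i j else 1 - edge_prob w i j)
  else 0.

(* iterated integral over m i.i.d. weights with density plf:
   int f(x_1) ... int f(x_m) F [:: x_1; ...; x_m] dx_m ... dx_1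
   (equal, by Tonelli, to the integral against the product measure) *)
Fixpoint wint (xmin beta : R) (m : nat) (F : seq R -> \bar R) : \bar R :=
  match m with
  | 0 => F [::]
  | m'.+1 => (\int[@lebesgue_measure R]_(x in `[xmin, +oo[)
               ((plf xmin beta x)%:E * wint xmin beta m' (fun s => F (x :: s))))%E
  end.

Definition rpl_prob (xmin beta : R) (n : nat) (A : graph n -> Prop) : \bar R :=
  wint xmin beta n (fun s =>
    (\sum_(E : graph n | `[< A E >]) graph_prob (fun i : 'I_n => nth 0 s i) E)%:E).

End RPL.

(* Main.v *)
Require Import Defs.
From HB Require Import structures.
From mathcomp Require Import all_boot all_order all_algebra.
From mathcomp Require Import all_classical all_reals all_analysis.
From mathcomp Require Import measurable_realfun ring lra zify.
Set Implicit Arguments. Unset Strict Implicit. Unset Printing Implicit Defensive.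
Import Order.TTheory GRing.Theory Num.Theory.
Local Open Scope ring_scope.

(** Let [H] be about [n^((1-eps)/2)] vertices of weight of order [sqrt n].  Pairs
    inside [H] are joined with probability bounded away from 0 and 1, and a
    second-moment argument gives every vertex of [H] order [sqrt n] pendant
    neighbours ("leaves") of bounded weight.  A leaf of [x] and a leaf of [y] are
    at distance 3 exactly when [x] and [y] are adjacent, so the labels of any
    choice of one leaf per vertex of [H] determine the graph on [H].  Choosing the
    leaves with the shortest labels shows that labels of total length [S] would
    encode the [~ n^(1-eps)] random bits of the graph on [H] into
    [O(S / sqrt n) + |H|] bits.  For a 2-hop cover, every edge [xy] of [H] forces
    [y] or its leaf among the landmarks of the chosen leaf of [x], or conversely,
    so these leaves store at least as many landmarks as [H] has edges, and the
    leaves can again be taken cheapest.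

    Concentration of the weights is obtained by dominating the indicator of the
    bad weight vectors by an explicit quadratic expression in functions of single
    weights, whose iterated integral is computed exactly; the weights are
    truncated at order [n] because their variance is infinite. *)

(** * Independent Bernoulli subsets of a finite type *)

Section Bernoulli.
Variables (R : realFieldType) (T : finType) (p : T -> R).
Implicit Types (E : {set T}) (Q : {set T} -> bool).

Definition bern E : R := \prod_e (if e \in E then p e else 1 - p e).
Definition bprob Q : R := \sum_(E | Q E) bern E.

(** Expanding the product of the sums [F e + G e] by distributivity gives one term per set [E]. A
    term vanishes exactly where [E] violates a prescription of [f], because the forbidden summand is
    set to 0. *)
Lemma bprob_cyl (f : T -> option bool) :
  bprob (fun E => [forall e, if f e is Some b then (e \in E) == b else true])
  = \prod_e (if f e is Some b then (if b then p e else 1 - p e) else 1).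
Proof.
pose F e := if f e is Some false then 0 else p e.
pose G e := if f e is Some true then 0 else 1 - p e.
transitivity (\prod_e (F e + G e)); last first.
  apply: eq_bigr => e _; rewrite /F /G.
  by case: (f e) => [[]|]; rewrite ?addr0 ?add0r // addrC subrK.
rewrite bigA_distr /bprob big_mkcond; apply: eq_bigr => E _ /=.
case: ifPn => [/forallP h|]; last first.
  rewrite negb_forall => /existsP[e he]; rewrite (bigD1 e) //= /F /G.
  by move: he; case: (f e) => [[]|] //; case: (e \in E); rewrite ?mul0r.
apply: eq_bigr => e _; move: (h e); rewrite /F /G.
by case: (f e) => [[]|] //; case: (e \in E).
Qed.

Lemma bprob_total : bprob predT = 1.
Proof.
transitivity (\prod_(e : T) (1 : R)); last by rewrite big1.
rewrite -(bprob_cyl (fun=> None)).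
by apply: eq_bigl => E; apply/esym/forallP.
Qed.

Hypothesis p01 : forall e, 0 <= p e <= 1.

Lemma bern_ge0 E : 0 <= bern E.
Proof.
by apply: prodr_ge0 => e _; have /andP[? ?] := p01 e; case: ifP; rewrite ?subr_ge0.
Qed.

Lemma bprob_ge0 Q : 0 <= bprob Q.
Proof. by apply: sumr_ge0 => E _; exact: bern_ge0. Qed.

(** The implication is asked only on sets of nonzero mass, so later uses may assume that every edge
    of a random graph is stored with its smaller endpoint first. *)
Lemma le_bprob Q1 Q2 : (forall E, bern E != 0 -> Q1 E -> Q2 E) ->
  bprob Q1 <= bprob Q2.
Proof.
move=> h; rewrite /bprob big_mkcond [leRHS]big_mkcond /=; apply: ler_sum => E _.
have [->|/h] := eqVneq (bern E) 0; first by rewrite !if_same.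
by have := bern_ge0 E; case: (Q1 E); case: (Q2 E) => // _ /(_ isT).
Qed.

Lemma bprobU Q1 Q2 : bprob (fun E => Q1 E || Q2 E) <= bprob Q1 + bprob Q2.
Proof.
rewrite /bprob big_mkcond [X in X + _]big_mkcond [X in _ + X]big_mkcond /=.
rewrite -big_split; apply: ler_sum => E _ /=; have := bern_ge0 E.
by case: (Q1 E); case: (Q2 E) => //=; lra.
Qed.

Lemma bprob_exists (I : finType) (A : {set I}) (Q : I -> {set T} -> bool) :
  bprob (fun E => [exists i in A, Q i E]) <= \sum_(i in A) bprob (Q i).
Proof.
rewrite /bprob.
under [leRHS]eq_bigr do rewrite big_mkcond /=.
rewrite big_mkcond exchange_big /=; apply: ler_sum => E _.
have h0 i : i \in A -> 0 <= (if Q i E then bern E else 0).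
  by move=> _; case: ifP => // _; exact: bern_ge0.
case: ifPn => [/existsP[i /andP[iA QE]]|_]; last exact: sumr_ge0.
rewrite (bigD1 i) //= QE lerDl; apply: sumr_ge0 => j /andP[jA _]; exact: h0.
Qed.

Lemma bprob_exp Q : bprob Q = \sum_E bern E * (Q E)%:R.
Proof.
rewrite /bprob big_mkcond; apply: eq_bigr => E _.
by case: (Q E); rewrite ?mulr1 ?mulr0.
Qed.

(** Chebyshev's inequality for the number of events that occur. The slack [r] bounds the pairwise
    correlation, so the variance is at most [S + r * S ^+ 2], where [S] is the mean; dividing by the
    square of [S / 2] gives [4 / S + 4 * r]. *)
Lemma second_moment (I : finType) (W : {set I}) (A : I -> {set T} -> bool)
    (r M : R) :
  0 <= r -> 0 < M -> M <= \sum_(i in W) bprob (A i) ->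
  {in W &, forall i j, i != j ->
    bprob (fun E => A i E && A j E) <= (1 + r) * (bprob (A i) * bprob (A j))} ->
  bprob (fun E => #|[set i in W | A i E]|%:R < M / 2) <= 4 / M + 4 * r.
Proof.
move=> r0 M0 leM hA; set S := \sum_(i in W) _ in leM.
have S0 : 0 < S by exact: lt_le_trans leM.
pose Y E : R := \sum_(i in W) (A i E)%:R.
have YE E : #|[set i in W | A i E]|%:R = Y E.
  rewrite /Y -natr_sum -sum1_card; congr (_%:R).
  under eq_bigl do rewrite inE.
  by rewrite big_mkcondr; apply: eq_bigr => i _; case: (A i E).
have EY : \sum_E bern E * Y E = S.
  rewrite /S; under [RHS]eq_bigr do rewrite bprob_exp.
  by rewrite exchange_big; apply: eq_bigr => E _; rewrite mulr_sumr.
have EY2 : \sum_E bern E * (Y E) ^+ 2 <= S + (1 + r) * S ^+ 2.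
  have -> : \sum_E bern E * (Y E) ^+ 2
      = \sum_(i in W) \sum_(j in W) bprob (fun E => A i E && A j E).
    under [RHS]eq_bigr => i _ do
      (under eq_bigr do rewrite bprob_exp; rewrite exchange_big /=).
    rewrite exchange_big; apply: eq_bigr => E _ /=.
    rewrite expr2 /Y mulr_suml mulr_sumr; apply: eq_bigr => i _.
    rewrite mulr_sumr mulr_sumr; apply: eq_bigr => j _.
    by rewrite -natrM mulnb.
  have -> : S + (1 + r) * S ^+ 2 = \sum_(i in W) (bprob (A i) +
      \sum_(j in W) (1 + r) * (bprob (A i) * bprob (A j))).
    rewrite big_split /= expr2 {3}/S mulr_suml mulr_sumr; congr (_ + _).
    by apply: eq_bigr => i _; rewrite mulr_sumr mulr_sumr.
  apply: ler_sum => i iW; rewrite (bigD1 i) //= lerD //.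
    by apply: le_bprob => E _ /andP[].
  rewrite [leRHS](bigD1 i) //= -[leLHS]add0r lerD //.
    by rewrite !mulr_ge0 ?bprob_ge0 // addr_ge0.
  by apply: ler_sum => j /andP[jW ji]; apply: hA => //; rewrite eq_sym.
clearbody S.
have EV : \sum_E bern E * (Y E - S) ^+ 2 <= S + r * S ^+ 2.
  have -> : \sum_E bern E * (Y E - S) ^+ 2 =
    \sum_E bern E * (Y E) ^+ 2 - 2 * S * (\sum_E bern E * Y E)
      + S ^+ 2 * \sum_E bern E.
    rewrite !mulr_sumr -sumrB -big_split /=; apply: eq_bigr => E _; ring.
  have -> : \sum_E bern E = 1 by exact: bprob_total.
  rewrite EY; nra.
(* A count below [M / 2] is below [S / 2], hence at distance at least [S / 2] from the mean. *)
have Ch : bprob (fun E => #|[set i in W | A i E]|%:R < M / 2) * (S / 2) ^+ 2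
    <= \sum_E bern E * (Y E - S) ^+ 2.
  rewrite bprob_exp mulr_suml; apply: ler_sum => E _; rewrite -mulrA.
  apply: ler_wpM2l; first exact: bern_ge0.
  rewrite YE; case: ltP => hY; last by rewrite mul0r sqr_ge0.
  rewrite mul1r; nra.
have {Ch EV} := le_trans Ch EV; set b := bprob _ => hb.
have hb' : b <= 4 / S + 4 * r.
  rewrite -(@ler_pM2r _ ((S / 2) ^+ 2)); last by rewrite exprn_gt0 ?divr_gt0.
  apply: le_trans hb _.
  have -> : (4 / S + 4 * r) * (S / 2) ^+ 2 = S + r * S ^+ 2; last by [].
  by field; rewrite gt_eqF.
apply: le_trans hb' _; rewrite lerD2r ler_pM2l //.
by rewrite lef_pV2.
Qed.

End Bernoulli.

(** * Distances between leaves, and the choice of cheap leaves *)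

Section Distance.
Variable n : nat.
Implicit Types (E : graph n) (x y z l : 'I_n).

Lemma adjC E x y : adj E x y = adj E y x.
Proof. by rewrite /adj orbC. Qed.

Lemma walk_len0 E x y : walk_len E x y 0%N = (x == y).
Proof.
apply/existsP/eqP => [[p]|->]; first by rewrite tuple0 => /andP[_ /eqP].
by exists [tuple]; rewrite /= eqxx.
Qed.

Lemma walk_lenS E x y k :
  walk_len E x y k.+1 = [exists z, adj E x z && walk_len E z y k].
Proof.
apply/existsP/existsP => [[p]|[z /andP[xz /existsP[p hp]]]].
  case/tupleP: p => z p /= /andP[/andP[xz pz] lz].
  by exists z; rewrite xz; apply/existsP; exists p; rewrite pz.
by exists [tuple of z :: p]; rewrite /= xz.
Qed.

Lemma walk_len1 E x y : walk_len E x y 1%N = adj E x y.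
Proof.
rewrite walk_lenS; apply/existsP/idP => [[z]|xy].
  by rewrite walk_len0 => /andP[xz /eqP <-].
by exists y; rewrite xy walk_len0 eqxx.
Qed.

(** The bound on [d] reflects that [gdist] searches only lengths below [n]; [find] returns [n] when
    the search fails. *)
Lemma gdist_someE E x y d : (d < n)%N ->
  (gdist E x y == Some d) =
  walk_len E x y d && all (fun k => ~~ walk_len E x y k) (iota 0 d).
Proof.
move=> dn; rewrite /gdist; set f := find _ _; case: ltnP => fn; last first.
  apply/esym/negbTE; rewrite negb_and; apply/orP; left; apply/negP => wd.
  have : has (walk_len E x y) (iota 0 n).
    by apply/hasP; exists d => //; rewrite mem_iota.
  by rewrite has_find size_iota ltnNge fn.
apply/eqP/andP => [[fd]|[wd /allP nw]].
  have hs : has (walk_len E x y) (iota 0 n) by rewrite has_find size_iota.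
  split; first by have := nth_find 0 hs; rewrite -/f nth_iota // fd.
  apply/allP => k; rewrite mem_iota /= add0n => kd.
  have := @before_find _ 0 (walk_len E x y) (iota 0 n) k.
  by rewrite -/f fd nth_iota ?add0n => [->|] //; exact: ltn_trans dn.
congr Some; apply/eqP; rewrite eqn_leq; apply/andP; split; rewrite leqNgt.
  apply/negP => df; have := before_find 0 df.
  by rewrite nth_iota // add0n wd.
apply/negP => fd; have : f \in iota 0 d by rewrite mem_iota.
move/nw; have hs : has (walk_len E x y) (iota 0 n) by rewrite has_find size_iota.
by have := nth_find 0 hs; rewrite -/f nth_iota // add0n => ->.
Qed.

Lemma gdist_lt E x y d : gdist E x y = Some d -> (d < n)%N.
Proof. by rewrite /gdist; case: ifP => // h [<-]. Qed.

Lemma gdist_walk E x y d : gdist E x y = Some d -> walk_len E x y d.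
Proof.
by move=> h; have := gdist_lt h; move/eqP: h => + dn; rewrite gdist_someE // => /andP[].
Qed.

Definition is_leaf E l x := forall y, adj E l y = (y == x).

(** A nontrivial walk from [l] to [l'] starts with the step to [x] and ends with the step from [y].
    The three inequalities exclude lengths 0, 1 and 2, and a walk of length 3 has only the step from
    [x] to [y] left in its middle. *)
Lemma leaf_gdist E l l' x y : (3 < n)%N -> is_leaf E l x -> is_leaf E l' y ->
  l != l' -> l' != x -> x != y -> (gdist E l l' == Some 3%N) = adj E x y.
Proof.
move=> n3 lx ly ll lx' xy.
have w1 : walk_len E l l' 1%N = false by rewrite walk_len1 lx; exact: negbTE.
have w2 : walk_len E l l' 2%N = false.
  apply/negbTE/negP; rewrite walk_lenS => /existsP[z].
  by rewrite lx walk_len1 adjC ly => /andP[/eqP-> /eqP xy']; rewrite xy' eqxx in xy.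
rewrite gdist_someE //= walk_len0 (negbTE ll) w1 w2 /= andbT.
rewrite walk_lenS; apply/existsP/idP => [[z]|axy].
  rewrite lx walk_lenS => /andP[/eqP-> /existsP[t]].
  by rewrite walk_len1 (adjC E t) ly => /andP[xt /eqP <-].
exists x; rewrite lx eqxx walk_lenS; apply/existsP; exists y.
by rewrite axy walk_len1 adjC ly eqxx.
Qed.

(** One of [a] and [b] is at most 1, so [z] is one of the two leaves or the only neighbour of one of
    them. *)
Lemma leaf_midpoint E l l' x y z a b : is_leaf E l x -> is_leaf E l' y ->
  gdist E l z = Some a -> gdist E z l' = Some b -> (a + b = 3)%N ->
  [\/ z = l, z = x, z = y | z = l'].
Proof.
move=> lx ly /gdist_walk wa /gdist_walk wb.
case: a wa => [|[|[|[|a]]]] wa; case: b wb => [|[|[|[|b]]]] wb //= _.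
- by move: wa; rewrite walk_len0 => /eqP; constructor 1.
- by move: wa; rewrite walk_len1 lx => /eqP ?; constructor 2.
- by move: wb; rewrite walk_len1 adjC ly => /eqP ?; constructor 3.
- by move: wb; rewrite walk_len0 => /eqP ?; constructor 4.
Qed.

(** The cheapest element of [F x] costs at most the average over [F x], which has at least [m]
    elements. Disjointness of the sets [F x] keeps the sum of their costs below the total cost. *)
Lemma cheap_selection (R : realFieldType) (H : {set 'I_n})
    (F : 'I_n -> {set 'I_n}) (f : 'I_n -> nat) (m : R) :
  0 < m -> {in H, forall x, m <= #|F x|%:R} ->
  {in H &, forall x y v, v \in F x -> v \in F y -> x = y} ->
  exists s : 'I_n -> 'I_n, {in H, forall x, s x \in F x} /\
    m * (\sum_(x in H) f (s x))%:R <= (\sum_v f v)%:R.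
Proof.
move=> m0 hm disjF.
have /boolp.choice[s sP] : forall x, exists v, x \in H -> v \in F x /\
    m * (f v)%:R <= (\sum_(v in F x) f v)%:R.
  move=> x.
  have [xH|_] := boolP (x \in H); last by exists x.
  have [v0 v0F] : exists v, v \in F x.
    by apply/card_gt0P; rewrite -(@ltr0n R); apply: lt_le_trans (hm _ xH).
  case: (arg_minnP f v0F) => v vF vmin; exists v => _; split => //.
  apply: le_trans (_ : #|F x|%:R * (f v)%:R <= _).
    by apply: ler_wpM2r => //; exact: hm.
  rewrite -natrM ler_nat -sum_nat_const; exact: leq_sum.
exists s; split=> [x /sP[]//|].
rewrite natr_sum mulr_sumr.
apply: (@le_trans _ _ (\sum_(x in H) (\sum_(v in F x) f v)%:R)).
  by apply: ler_sum => x /sP[].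
rewrite -natr_sum ler_nat.
under eq_bigr do rewrite big_mkcond.
rewrite exchange_big; apply: leq_sum => v _ /=.
(* After the exchange of sums, [f v] is counted once for each [x] with [v] in [F x], so at most
   once. *)
rewrite -big_mkcondr /= sum_nat_const -[leqRHS]mul1n leq_mul2r.
apply/orP; right; apply/card_le1_eqP => x y /andP[xH vx] /andP[yH vy].
exact: (disjF y x yH xH v vy vx).
Qed.

End Distance.

(** * What labels and covers must store when core vertices have many leaves *)

Section HighDegree.
Variables (n : nat) (E : graph n) (H W : {set 'I_n}) (F : 'I_n -> {set 'I_n}).
Hypotheses (n3 : (3 < n)%N) (suppE : forall e, e \in E -> (e.1 < e.2)%N).
Hypotheses (HW : forall x, x \in H -> x \in W -> False).
Hypotheses (FW : forall x, F x \subset W).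
Hypotheses (Fleaf : {in H, forall x l, l \in F x -> is_leaf E l x}).
Variables (R : realFieldType) (m : R).
Hypotheses (m0 : 0 < m) (hm : {in H, forall x, m <= #|F x|%:R}).

Lemma leaf_sets_disjoint : {in H &, forall x y v, v \in F x -> v \in F y -> x = y}.
Proof.
move=> x y xH yH v vx vy; apply/eqP.
by rewrite -(Fleaf yH vy) (Fleaf xH vx).
Qed.

Lemma leaf_notin x y l : x \in H -> l \in F y -> l != x.
Proof.
move=> xH lF; apply: contraTN (xH) => /eqP <-.
by apply/negP => /HW; apply; move/fintype.subsetP: (FW y); exact.
Qed.

(** Each core vertex borrows the label of its cheapest leaf. By [leaf_gdist], two borrowed labels
    decode to 3 exactly when their core vertices are adjacent. *)
Lemma labels_decode_core (D : seq bool -> seq bool -> option nat)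
    (L : 'I_n -> seq bool) : (forall x y, D (L x) (L y) = gdist E x y) ->
  exists g : 'I_n -> seq bool,
    m * (\sum_(x in H) size (g x))%:R <= (\sum_v size (L v))%:R /\
    {in H &, forall x y, x != y -> adj E x y = (D (g x) (g y) == Some 3%N)}.
Proof.
move=> DL; have [s [sF sm]] :=
  cheap_selection (fun v => size (L v)) m0 hm leaf_sets_disjoint.
exists (L \o s); split => // x y xH yH xy /=.
rewrite DL (leaf_gdist n3 (Fleaf xH (sF _ xH)) (Fleaf yH (sF _ yH))) //.
- apply: contraNneq xy => sxy.
  by rewrite (leaf_sets_disjoint xH yH (sF _ xH)) // sxy sF.
- by apply: leaf_notin (sF _ yH).
Qed.

(** Each core edge is charged to one endpoint [v], whose chosen leaf has the other endpoint or its
    leaf as a landmark. Distinct edges get distinct charges, and the charges at [v] inject into the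
    landmarks of its leaf. *)
Lemma two_hop_core_edges (L : 'I_n -> {set 'I_n}) : two_hop_cover E L ->
  m * #|[set e in E | (e.1 \in H) && (e.2 \in H)]|%:R <= (\sum_v #|L v|)%:R.
Proof.
move=> hL; have [s [sF sm]] :=
  cheap_selection (fun v => #|L v|) m0 hm leaf_sets_disjoint.
apply: le_trans sm; rewrite ler_pM2l // ler_nat.
pose B v := [set o in H | (o \in L (s v)) || (s o \in L (s v))].
have leB v : (#|B v| <= #|L (s v)|)%N.
  (* The map [h] is injective: leaves lie outside [H], and a leaf determines its core vertex. *)
  pose h o := if o \in L (s v) then o else s o.
  rewrite -(@card_in_imset _ _ h).
    apply/subset_leq_card/fintype.subsetP => _ /imsetP[u uB ->].
    by move: uB; rewrite !inE /h => /andP[_]; case: ifP.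
  move=> o o'; rewrite !inE => /andP[oH ho] /andP[oH' ho']; rewrite /h.
  case: ifP => _; case: ifP => _ //.
  - by move=> e; have := leaf_notin oH (sF _ oH'); rewrite -e eqxx.
  - by move=> e; have := leaf_notin oH' (sF _ oH); rewrite -e eqxx.
  - by move=> e; apply: (leaf_sets_disjoint oH oH' (sF _ oH)); rewrite e sF.
apply: (@leq_trans (\sum_(v in H) #|B v|)); last exact: leq_sum.
have -> : (\sum_(v in H) #|B v|)%N = #|[set e : 'I_n * 'I_n | (e.1 \in H) && (e.2 \in B e.1)]|.
  under eq_bigr do rewrite -sum1_card.
  by rewrite pair_big_dep /= -sum1_card; apply: eq_bigl => e; rewrite [RHS]inE.
(* An edge is reversed when its first endpoint cannot take the charge. Injectivity survives because
   [suppE] keeps a pair and its reversal from both lying in [E]. *)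
pose h (e : 'I_n * 'I_n) := if e.2 \in B e.1 then e else (e.2, e.1).
rewrite -[leqLHS](@card_in_imset _ _ h).
  apply/subset_leq_card/fintype.subsetP => _ /imsetP[[x y] xyB ->].
  rewrite inE in xyB; case/andP: xyB => /= xyE /andP[xH yH].
  rewrite /h /=; case: ifPn => [yB|nyB]; rewrite inE /= ?xH ?yH //=.
  have xy : x != y by apply: contraTneq (suppE xyE) => /= ->; rewrite ltnn.
  have dxy : gdist E (s x) (s y) = Some 3%N.
    apply/eqP; rewrite (leaf_gdist n3 (Fleaf xH (sF _ xH)) (Fleaf yH (sF _ yH))) //.
    + by rewrite /adj xyE.
    + apply: contraNneq xy => sxy.
      by rewrite (leaf_sets_disjoint xH yH (sF _ xH)) // sxy sF.
    + by apply: leaf_notin (sF _ yH).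
  have [[z zL [a [b [da db ab]]]] _] := hL _ _ _ dxy.
  move: zL nyB; rewrite !inE xH yH /= => /andP[zx zy].
  have [e|e|e|e] := leaf_midpoint (Fleaf xH (sF _ xH)) (Fleaf yH (sF _ yH)) da db ab;
    rewrite {}e in zx zy; by rewrite ?zx ?zy ?orbT.
move=> [x y] [x' y']; rewrite !inE /= => /andP[/suppE /= xy _] /andP[/suppE /= xy' _].
rewrite /h /=; case: ifP => _; case: ifP => _ // [ex ey]; last by rewrite ex ey.
- by move: xy; rewrite ex ey ltnNge ltnW.
- by move: xy; rewrite ex ey ltnNge ltnW.
Qed.

End HighDegree.

(* Prefix code: each bit is preceded by [true], and [false] ends a string. *)
Definition encode_bits (s : seq bool) : seq bool :=
  rcons (flatten [seq [:: true; c] | c <- s]) false.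

Fixpoint decode_bits (cur b : seq bool) : seq (seq bool) :=
  match b with
  | true :: c :: b' => decode_bits (rcons cur c) b'
  | false :: b' => cur :: decode_bits [::] b'
  | _ => [::]
  end.

Lemma decode_encode cur s b :
  decode_bits cur (encode_bits s ++ b) = (cur ++ s) :: decode_bits [::] b.
Proof.
elim: s cur => [|c s IH] cur; first by rewrite cats0.
by rewrite /= IH cat_rcons.
Qed.

Lemma decode_flatten ss b :
  decode_bits [::] (flatten (map encode_bits ss) ++ b)
  = ss ++ decode_bits [::] b.
Proof. by elim: ss => //= s ss IH; rewrite -catA decode_encode IH. Qed.

Lemma size_encode_bits s : size (encode_bits s) = (2 * size s).+1.
Proof. by rewrite /encode_bits size_rcons; elim: s => //= c s [->]; rewrite mulnS. Qed.

(** The code spends two bits per label bit and one terminator per label. Padding with [false] fixes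
    the length and only appends empty strings after the decoded labels, which leaves their indices
    unchanged. *)
Lemma code_tuple (I : finType) (H : {set I}) (g : I -> seq bool) (T : nat) :
  (\sum_(x in H) size (g x) <= T)%N ->
  exists b : (2 * T + #|H|)%N.-tuple bool,
    {in H, forall x, nth [::] (decode_bits [::] b) (index x (enum H)) = g x}.
Proof.
move=> leT; pose c := flatten [seq encode_bits (g x) | x <- enum H].
have sc : (size c <= 2 * T + #|H|)%N.
  rewrite /c size_flatten /shape -map_comp sumnE big_map big_enum /=.
  under eq_bigr do rewrite /= size_encode_bits -addn1.
  by rewrite big_split /= sum1_card leq_add2r -big_distrr leq_mul2l.
have sb : size (c ++ nseq (2 * T + #|H| - size c) false) == (2 * T + #|H|)%N.
  by rewrite size_cat size_nseq subnKC.
exists (Tuple sb) => x xH /=; rewrite /c map_comp decode_flatten nth_cat size_map.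
rewrite index_mem mem_enum xH (nth_map x) ?index_mem ?mem_enum //.
by rewrite nth_index ?mem_enum.
Qed.

(** * Counting labelings and edges of the core *)

Section Core.
Variables (n : nat) (R : realType) (p : 'I_n * 'I_n -> R).
Hypothesis p01 : forall e, 0 <= p e <= 1.
Implicit Types (E : graph n) (x y l : 'I_n).

Definition core_pairs (H : {set 'I_n}) : {set 'I_n * 'I_n} :=
  [set e : 'I_n * 'I_n | [&& (e.1 < e.2)%N, e.1 \in H & e.2 \in H]].

(** The square of [H] splits into increasing pairs, decreasing pairs and the diagonal; the first two
    are equinumerous by symmetry. *)
Lemma card_core_pairs (H : {set 'I_n}) :
  (2 * #|core_pairs H| + #|H| = #|H| * #|H|)%N.
Proof.
have E1 : #|core_pairs H| = (\sum_(x in H) \sum_(y in H) (x < y))%N.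
  rewrite pair_big /= -sum1_card [RHS]big_mkcond [LHS]big_mkcond /=.
  apply: eq_bigr => e _; rewrite inE.
  by case: (e.1 < e.2)%N; case: (e.1 \in H); case: (e.2 \in H).
have E2 : #|core_pairs H| = (\sum_(x in H) \sum_(y in H) (y < x))%N.
  by rewrite E1 exchange_big.
rewrite mul2n -addnn {1}E1 E2 -sum_nat_const -sum1_card -!big_split /=.
apply: eq_bigr => x xH; rewrite -big_split /=.
rewrite (bigD1 x) //= [RHS](bigD1 x) //= ltnn addnC addnA addn0; congr (_ + _)%N.
apply: eq_bigr => y /andP[_ yx]; rewrite -val_eqE /= in yx.
by case: ltngtP yx.
Qed.

(** A union bound over all bit strings of the code length. One string prescribes the whole graph on
    [H], and each pair agrees with the prescription with probability at most [q]. *)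
Lemma core_labels_prob (H : {set 'I_n}) (T : nat) (q : R) (Q : graph n -> bool)
    (D : seq bool -> seq bool -> option nat) :
  {in core_pairs H, forall e, p e <= q /\ 1 - p e <= q} ->
  (forall E, bern p E != 0 -> Q E -> exists2 g : 'I_n -> seq bool,
    (\sum_(x in H) size (g x) <= T)%N &
    {in H &, forall x y, (x < y)%N ->
      ((x, y) \in E) = (D (g x) (g y) == Some 3%N)}) ->
  bprob p Q <= 2 ^+ (2 * T + #|H|) * q ^+ #|core_pairs H|.
Proof.
move=> hq hQ; pose N := (2 * T + #|H|)%N.
pose str (b : N.-tuple bool) x := nth [::] (decode_bits [::] b) (index x (enum H)).
pose f b (e : 'I_n * 'I_n) := if e \in core_pairs H
  then Some (D (str b e.1) (str b e.2) == Some 3%N) else None.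
pose C b E := [forall e, if f b e is Some c then (e \in E) == c else true].
apply: (@le_trans _ _ (bprob p (fun E => [exists b in [set: N.-tuple bool]%SET, C b E]))).
  apply: le_bprob => // E Ep /(hQ _ Ep)[g gT gE].
  have [b bP] := code_tuple gT.
  apply/existsP; exists b; rewrite finset.in_setT; apply/forallP => -[x y].
  rewrite /f; case: ifP => //; rewrite inE /= => /and3P[xy xH yH].
  by rewrite gE // /str !bP.
apply: le_trans (bprob_exists p01 _ _) _.
apply: (@le_trans _ _ (\sum_(b in [set: N.-tuple bool]%SET) q ^+ #|core_pairs H|)).
  apply: ler_sum => b _; rewrite bprob_cyl.
  rewrite -prodr_const [leRHS]big_mkcond; apply: ler_prod => e _.
  have /andP[p0 p1] := p01 e; rewrite /f; case: ifP => [eH|_]; last by rewrite ler01 lexx.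
  by have [? ?] := hq _ eH; case: ifP; rewrite ?subr_ge0 ?p0 ?p1.
rewrite sumr_const cardsT card_tuple card_bool -[leLHS]mulr_natl.
by rewrite natrX.
Qed.

(** Distinct pairs are independent, so [second_moment] applies with [r = 0]. *)
Lemma core_edges_prob (H : {set 'I_n}) (a : R) :
  0 < a -> (1 < #|H|)%N -> {in core_pairs H, forall e, a <= p e} ->
  bprob p (fun E => #|[set e in E | (e.1 \in H) && (e.2 \in H)]|%:R
     < a * #|core_pairs H|%:R / 2) <= 4 / (a * #|core_pairs H|%:R).
Proof.
move=> a0 H1 ha; rewrite -[leRHS]addr0 -[X in _ + X](mulr0 4).
have P1 e : bprob p (fun E => e \in E) = p e.
  transitivity (\prod_e' (if e' == e then p e' else 1)); last first.
    by rewrite -big_mkcond big_pred1_eq.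
  transitivity (bprob p (fun E => [forall e', if (if e' == e then Some true else None)
      is Some b then (e' \in E) == b else true])); last first.
    by rewrite bprob_cyl; apply: eq_bigr => e' _; case: (e' == e).
  apply: eq_bigl => E; apply/idP/forallP => [eE e'|/(_ e)]; last by rewrite eqxx => /eqP.
  by case: eqP => // ->; rewrite eE.
have hc : (0 < #|core_pairs H|)%N.
  by have := card_core_pairs H; case: #|core_pairs H| => //; nia.
apply: (le_trans _ (second_moment p01 (W := core_pairs H)
   (A := fun e E => e \in E) (M := a * #|core_pairs H|%:R) (lexx 0) _ _ _)).
- apply: le_bprob => // E _; apply: le_lt_trans; rewrite ler_nat.
  apply/subset_leq_card/fintype.subsetP => e; rewrite !inE.
  by move=> /andP[/and3P[_ -> ->] ->].
- by rewrite mulr_gt0 // ltr0n.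
- rewrite mulr_natr -sumr_const; apply: ler_sum => e eH.
  by rewrite P1 ha.
move=> e e' _ _ ee'; rewrite addr0 mul1r !P1.
apply: (@le_trans _ _ (bprob p (fun E => [forall e0,
    if (if (e0 == e) || (e0 == e') then Some true else None)
    is Some b then (e0 \in E) == b else true]))).
  apply: le_bprob => // E _ /andP[eE eE']; apply/forallP => e0.
  by case: ifP => // /orP[] /eqP->; rewrite ?eE ?eE'.
rewrite bprob_cyl (bigD1 e) //= (bigD1 e') 1?eq_sym //= !eqxx orbT /=.
rewrite big1 ?mulr1 // => e0 /andP[n1 n2]; by rewrite (negbTE n1) (negbTE n2).
Qed.

(** * Leaf events and their correlation *)

Definition opair x y := if (x < y)%N then (x, y) else (y, x).

Lemma opairC x y : opair x y = opair y x.
Proof.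
rewrite /opair; case: ltngtP => // xy; have e : x = y by exact/val_inj.
by rewrite e.
Qed.

Lemma opair_inj x : injective (opair x).
Proof. by move=> y z; rewrite /opair; do 2 case: ifP => _; move=> [] // -> ->. Qed.

Definition star l := [set opair l y | y in predC1 l].

Lemma opair_star l y : (opair l y \in star l) = (y != l).
Proof. by rewrite mem_imset //; exact: opair_inj. Qed.

Lemma star_inter l l' e : l != l' -> e \in star l -> e \in star l' ->
  e = opair l l'.
Proof.
move=> ll /imsetP[y yl ->] /imsetP[y' yl' eyy].
congr (opair _ _); move: eyy; rewrite /opair.
by do 2 case: ifP => _; move=> [] // e1 e2; move: ll; rewrite ?e1 ?e2 eqxx.
Qed.

(** Phrased as a cylinder on the pairs at [l], so that [bprob_cyl] turns its probability into a
    product. On graphs with ordered edges it implies [is_leaf]. *)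
Definition leaf_event l x E : bool :=
  [forall e, if (if e \in star l then Some (e == opair l x) else None) is Some b
             then (e \in E) == b else true].

Lemma leaf_eventP l x E : (forall e, e \in E -> (e.1 < e.2)%N) -> l != x ->
  leaf_event l x E -> is_leaf E l x.
Proof.
move=> sE lx /forallP h y.
have irr z : (z, z) \notin E by apply/negP => /sE; rewrite ltnn.
have [->|yl] := eqVneq y l; first by rewrite /adj (negbTE (irr _)) (negbTE lx).
have -> : adj E l y = (opair l y \in E).
  rewrite /adj /opair; case: ltnP => ly.
    by case: ((y, l) \in E) (sE (y, l)) => [/(_ isT)/=|_]; [lia|rewrite orbF].
  by case: ((l, y) \in E) (sE (l, y)) => [/(_ isT)/=|_]; [lia|].
have := h (opair l y); rewrite opair_star yl => /eqP->.
exact: inj_eq (@opair_inj l) _ _.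
Qed.

Lemma leaf_probE l x : bprob p (leaf_event l x) = \prod_e
  (if e \in star l then (if e == opair l x then p e else 1 - p e) else 1).
Proof. by rewrite bprob_cyl; apply: eq_bigr => e _; case: ifP. Qed.

Lemma leaf_prob_pair l l' x : l != l' -> l != x -> l' != x ->
  bprob p (fun E => leaf_event l x E && leaf_event l' x E) * (1 - p (opair l l'))
  <= bprob p (leaf_event l x) * bprob p (leaf_event l' x).
Proof.
move=> ll lx lx'; have /andP[q0 q1] := p01 (opair l l').
have sx z z' e : z != z' -> z != x -> z' != x -> e \in star z -> (e == opair z' x) = false.
  move=> zz zx zx' ez; apply/negP => /eqP e'.
  have : e \in star z' by rewrite e' opair_star eq_sym.
  move/(star_inter zz ez); rewrite e' (opairC z) => /opair_inj e0.
  by rewrite e0 eqxx in zx.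
pose f e := if (e \in star l) || (e \in star l')
  then Some ((e == opair l x) || (e == opair l' x)) else None.
have le1 : bprob p (fun E => leaf_event l x E && leaf_event l' x E) <=
    bprob p (fun E => [forall e, if f e is Some b then (e \in E) == b else true]).
  apply: le_bprob => // E _ /andP[/forallP h /forallP h'].
  apply/forallP => e; rewrite /f; have := h e; have := h' e.
  case: ifPn => [e1|_]; case: ifPn => [e2|_] //=.
  - by move=> _ /eqP->; rewrite (sx l l') ?orbF.
  - by move=> /eqP-> _; rewrite (sx l' l) // eq_sym.
  - by move=> _ /eqP->; rewrite (sx l l') ?orbF.
apply: le_trans (ler_wpM2r _ le1) _; first by rewrite subr_ge0.
rewrite bprob_cyl !leaf_probE -big_split /= mulrC.
rewrite (bigD1 (opair l l')) //= [leRHS](bigD1 (opair l l')) //= mulrA.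
have i1 : opair l l' \in star l by rewrite opair_star eq_sym.
have i2 : opair l l' \in star l' by rewrite opairC opair_star.
have n1 : opair l l' == opair l x = false by rewrite (inj_eq (@opair_inj l)) (negbTE lx').
have n2 : opair l l' == opair l' x = false.
  by rewrite (opairC l) (inj_eq (@opair_inj l')) (negbTE lx).
rewrite /f i1 i2 n1 n2 /=; rewrite le_eqVlt; apply/orP; left; apply/eqP; congr (_ * _).
apply: eq_bigr => e ne.
case: (boolP (e \in star l)) => e1; case: (boolP (e \in star l')) => e2 /=.
- by move: ne; rewrite (star_inter ll e1 e2) eqxx.
- by rewrite (sx l l') // orbF mulr1; case: ifP.
- by rewrite (sx l' l e _ lx' lx e2) ?mul1r ; [case: ifP|rewrite eq_sym].
- by rewrite mulr1.
Qed.

(** The absence of each other pair has probability at least [expR (- 2 * t)], where [t <= 1 / 2] is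
    the probability of the pair. The term of [x] may stay in the exponent, since it only lowers the
    bound. *)
Lemma leaf_prob_ge l x : l != x -> (forall y, y != l -> p (opair l y) <= 1 / 2) ->
  p (opair l x) * expR (- 2 * \sum_(y | y != l) p (opair l y))
    <= bprob p (leaf_event l x).
Proof.
move=> lx hp; rewrite leaf_probE -big_mkcond /=.
rewrite big_imset /=; last by move=> ? ? _ _; exact: opair_inj.
rewrite [leRHS](bigD1 x) /=; last by rewrite inE eq_sym.
rewrite eqxx.
have /andP[q0 _] := p01 (opair l x); apply: ler_wpM2l => //.
rewrite mulr_sumr expR_sum (bigD1 x) 1?eq_sym //=.
rewrite -[leRHS]mul1r; apply: ler_pM; rewrite ?expR_ge0 //.
- by apply: prodr_ge0 => *; exact: expR_ge0.
- by rewrite -[leRHS]expR0 ler_expR; lra.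
apply: ler_prod => y /andP[yl yx]; rewrite expR_ge0 /=.
rewrite (inj_eq (@opair_inj l)) (negbTE yx).
have := hp _ yl; have /andP[] := p01 (opair l y).
move: (p _) => t t0 _ t1; have e1 := expR_ge1Dx (2 * t).
rewrite mulNr expRN invf_ple ?posrE ?expR_gt0 //; last lra.
(* For [t] between 0 and [1 / 2], [(1 - t) * (1 + 2 * t)] is at least 1. *)
apply: le_trans e1; rewrite -[leLHS]mul1r ler_pdivrMr; nra.
Qed.

End Core.

(** * Power-law integrals of a single weight *)

Section Integrals.
Import numFieldNormedType.Exports.
Local Open Scope classical_set_scope.
Variable R : realType.
Notation mu := (@lebesgue_measure R).

(* No measurability is needed: the integral of a nonnegative function is a
   supremum over the simple functions below it. *)
Lemma ge0_le_integral_sup (D : set R) (f g : R -> \bar R) :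
  (forall x, D x -> 0 <= f x)%E -> (forall x, D x -> f x <= g x)%E ->
  (\int[mu]_(x in D) f x <= \int[mu]_(x in D) g x)%E.
Proof.
move=> f0 fg; rewrite !ge0_integralE //; last first.
  by move=> x Dx; exact: le_trans (f0 _ Dx) (fg _ Dx).
apply: le_ereal_sup => _ [h hf <-]; exists h => // x.
apply: le_trans (hf x) _; rewrite /patch; case: ifPn => // /set_mem; exact: fg.
Qed.

Lemma powRN_cvgy0 (a : R) : 0 < a -> x `^ (- a) @[x --> +oo%R] --> (0 : R).
Proof.
move=> a0; apply/cvgr0Pnorm_le => e e0; near=> x.
have x0 : 0 < x by near: x; exact: nbhs_pinfty_gt.
rewrite ger0_norm ?powR_ge0 // powRN invf_ple ?posrE ?powR_gt0 //.
have -> : e^-1 = (e^-1 `^ a^-1) `^ a.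
  by rewrite -powRrM mulVf ?gt_eqF // powRr1 // invr_ge0 ltW.
apply: ge0_ler_powR; rewrite ?nnegrE ?powR_ge0 ?(ltW x0) ?(ltW a0) //.
Unshelve. all: by end_near. Qed.

Lemma integral_powRN (T s : R) : 0 < T -> 1 < s ->
  (\int[mu]_(t in `[T, +oo[) (t `^ (- s))%:E = (T `^ (1 - s) / (s - 1))%:E)%E.
Proof.
move=> T0 s1; have s10 : s - 1 != 0 by rewrite subr_eq0 gt_eqF.
pose F (t : R) := (1 - s)^-1 * t `^ (1 - s).
have n1s : 1 - s != 0 by rewrite -opprB oppr_eq0.
have derF (t : R) : 0 < t -> is_derive t 1 F (t `^ (- s)).
  move=> t0; have -> : t `^ (- s) = (1 - s)^-1 * ((1 - s) * t `^ (1 - s - 1)).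
    by rewrite mulKf // addrAC subrr add0r.
  exact: (is_deriveZ (1 - s)^-1 (is_derive1_powR (1 - s) t0)).
have cF (t : R) : 0 < t -> {for t, continuous F}.
  move=> t0; apply/differentiable_continuous/derivable1_diffP.
  by have [] := derF _ t0.
rewrite (@ge0_continuous_FTC2y _ _ F _ 0).
- by rewrite -EFinB /F sub0r; congr EFin; field; apply/andP.
- by move=> *; exact: powR_ge0.
- apply: continuous_in_subspaceT => t.
  rewrite inE /= in_itv /= andbT => Tt; apply/differentiable_continuous.
  apply/derivable1_diffP; have [] // := @is_derive1_powR R (- s) t.
  exact: lt_le_trans Tt.
- rewrite -(mulr0 (1 - s)^-1); apply: cvgMr.
  have := @powRN_cvgy0 (s - 1); rewrite opprB; apply; lra.
- by move=> x Tx; have [] := derF x (lt_trans T0 Tx).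
- exact/cvg_at_right_filter/cF.
- move=> x; rewrite in_itv /= andbT => Tx; rewrite derive1E.
  by have [_ ->] := derF x (lt_trans T0 Tx).
Qed.


Variables (xmin beta : R).
Hypotheses (xmin0 : 0 < xmin) (beta1 : 1 < beta).
Notation dom := `[xmin, +oo[%classic.
Notation dens := (plf xmin beta).

Lemma domE x : dom x = (xmin <= x) :> Prop.
Proof. by rewrite /= in_itv /= andbT. Qed.

Lemma dens_ge0 x : 0 <= dens x.
Proof.
rewrite /plf; case: ifP => // _; rewrite !mulr_ge0 ?powR_ge0 //.
have b1 := beta1; lra.
Qed.

Lemma measurable_dens : measurable_fun [set: R] dens.
Proof.
apply: measurable_fun_ifT => //.
- exact: measurable_fun_ler.
- by apply: measurable_funM => //; exact: measurable_powR.
Qed.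

(** Integrability travels with the value, so that linear combinations need no side conditions. *)
Definition mean_is (phi : R -> R) (v : R) :=
  mu.-integrable dom (fun x => (dens x * phi x)%:E) /\
  (\int[mu]_(x in dom) (dens x * phi x)%:E = v%:E)%E.

Lemma mean_is_lin (a b : R) phi v psi u : mean_is phi v -> mean_is psi u ->
  mean_is (fun x => a * phi x + b * psi x) (a * v + b * u).
Proof.
move=> [i1 e1] [i2 e2].
have E x : ((dens x * (a * phi x + b * psi x))%:E
    = a%:E * (dens x * phi x)%:E + b%:E * (dens x * psi x)%:E)%E.
  by rewrite -!EFinM -EFinD; congr EFin; ring.
have j1 : mu.-integrable dom (fun x => a%:E * (dens x * phi x)%:E)%E.
  exact: integrableZl.
have j2 : mu.-integrable dom (fun x => b%:E * (dens x * psi x)%:E)%E.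
  exact: integrableZl.
split.
  have j : mu.-integrable dom
      (fun x => a%:E * (dens x * phi x)%:E + b%:E * (dens x * psi x)%:E)%E.
    exact: integrableD.
  by apply: eq_integrable j => // x _; rewrite E.
under eq_integral do rewrite E.
by rewrite integralD // !integralZl // e1 e2.
Qed.

Lemma eq_mean_is phi psi v u : mean_is phi v ->
  (forall x, xmin <= x -> phi x = psi x) -> v = u -> mean_is psi u.
Proof.
move=> [i1 e1] e <-; have E x : x \in dom -> (dens x * phi x)%:E = (dens x * psi x)%:E.
  by move=> /set_mem; rewrite domE => xD; rewrite e.
split; first exact: eq_integrable i1.
by rewrite -e1; apply: eq_integral => x /E.
Qed.

Lemma mean_is_le phi v psi u : mean_is phi v -> mean_is psi u ->
  (forall x, xmin <= x -> phi x <= psi x) -> v <= u.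
Proof.
move=> [i1 e1] [i2 e2] h; rewrite -lee_fin -e1 -e2; apply: le_integral => //.
move=> x /set_mem; rewrite domE => xD.
by rewrite lee_fin ler_wpM2l ?dens_ge0 ?h.
Qed.

Lemma mean_is_dominated (phi psi : R -> R) u : measurable_fun [set: R] phi -> mean_is psi u ->
  (forall x, xmin <= x -> `|phi x| <= psi x) -> exists v, mean_is phi v.
Proof.
move=> mphi [i2 e2] h.
have i1 : mu.-integrable dom (fun x => (dens x * phi x)%:E).
  apply: (le_integrable _ _ _ i2) => //.
    apply/measurable_EFinP/measurable_funTS/measurable_funM => //.
    exact: measurable_dens.
  move=> x; rewrite domE => xD; rewrite /= lee_fin !normrM.
  by rewrite ler_wpM2l // (le_trans (h _ xD)) // ler_norm.
exists (fine (\int[mu]_(x in dom) (dens x * phi x)%:E)); split => //.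
by rewrite fineK //; exact: integrable_fin_num.
Qed.

Lemma mean_is_tail_pow (T r : R) : xmin <= T -> r < beta - 1 ->
  mean_is (fun t => (T <= t)%R%:R * t `^ r)
    ((beta - 1) * xmin `^ (beta - 1) * T `^ (1 + r - beta) / (beta - 1 - r)).
Proof.
move=> xT rb; have T0 := lt_le_trans xmin0 xT; have b1 := beta1.
pose Z := (beta - 1) * xmin `^ (beta - 1).
have Z0 : 0 <= Z by rewrite mulr_ge0 ?powR_ge0 //; lra.
have mZ : measurable_fun [set: R] (fun t : R => dens t * ((T <= t)%R%:R * t `^ r)).
  apply: measurable_funM; first exact: measurable_dens.
  apply: measurable_funM; last exact: measurable_powR.
  have -> : (fun t : R => (T <= t)%R%:R : R) = (fun t => if T <= t then 1 else 0).
    by apply/funext => t; case: ifP.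
  by apply: measurable_fun_ifT => //; exact: measurable_fun_ler.
have Ev : (\int[mu]_(x in dom) (dens x * ((T <= x)%R%:R * x `^ r))%:E =
    ((beta - 1) * xmin `^ (beta - 1) * T `^ (1 + r - beta) / (beta - 1 - r))%:E)%E.
  transitivity (\int[mu]_(x in `[T, +oo[) (Z%:E * (x `^ (- (beta - r)))%:E))%E.
    rewrite integral_mkcond [RHS]integral_mkcond; apply: eq_integral => x _.
    rewrite /patch !mem_setE /= !in_itv /= !andbT.
    case: (leP T x) => Tx.
      rewrite (le_trans xT Tx) /plf (le_trans xT Tx) mul1r -EFinM -mulrA -powRD.
        by congr (_ * _ `^ _)%:E; ring.
      by apply/implyP => _; rewrite gt_eqF // (lt_le_trans T0).
    by rewrite mul0r mulr0; case: ifP.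
  rewrite ge0_integralZl_EFin //=.
  - rewrite integral_powRN //; last lra.
    by rewrite -EFinM /Z -mulrA; congr (_ * (_ `^ _ / _))%:E; ring.
  - by move=> x _; rewrite lee_fin powR_ge0.
  - by apply/measurable_EFinP/measurable_funTS; exact: measurable_powR.
split => //; apply/integrableP; split.
  exact/measurable_EFinP/measurable_funTS.
under eq_integral => x _.
  rewrite gee0_abs; last by rewrite lee_fin !mulr_ge0 ?dens_ge0 ?powR_ge0.
  over.
by rewrite /= Ev ltry.
Qed.

Lemma mean_is_tail (T : R) : xmin <= T ->
  mean_is (fun t => (T <= t)%R%:R) ((T / xmin) `^ (1 - beta)).
Proof.
move=> xT; have T0 := lt_le_trans xmin0 xT; have b1 := beta1.
apply: (eq_mean_is (@mean_is_tail_pow T 0 xT _)) => [|x _|]; first lra.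
  by rewrite powRr0 mulr1.
rewrite powRM ?invr_ge0 ?(ltW T0) ?(ltW xmin0) // -[xmin^-1]powR_inv1 ?(ltW xmin0) // -powRrM.
rewrite mulN1r opprB addr0 subr0; have : beta - 1 != 0 by rewrite subr_eq0 gt_eqF.
by move=> ?; field.
Qed.

Lemma mean_is_pow (r : R) : r < beta - 1 ->
  exists v, mean_is (fun t => t `^ r) v.
Proof.
move=> rb; eexists; apply: (eq_mean_is (@mean_is_tail_pow xmin r (lexx _) rb)) => //.
by move=> x ->; rewrite mul1r.
Qed.

Lemma mean_is1 : mean_is (fun=> 1) 1.
Proof.
apply: (eq_mean_is (@mean_is_tail xmin (lexx _))) => [x ->//|].
by rewrite divff ?gt_eqF // powR1.
Qed.

(** * Iterated integrals over independent weights *)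

Lemma wint_ge0 m F : (forall s, size s = m -> all (<=%R xmin) s -> (0 <= F s)%E) ->
  (0 <= wint xmin beta m F)%E.
Proof.
elim: m F => [|m IH] F F0 /=; first exact: F0.
apply: integral_ge0 => x; rewrite domE => xD.
rewrite mule_ge0 ?lee_fin ?dens_ge0 //.
by apply: IH => s sm sx; apply: F0; rewrite /= ?sm ?xD.
Qed.

Lemma le_wint m F G :
  (forall s, size s = m -> all (<=%R xmin) s -> (0 <= F s)%E /\ (F s <= G s)%E) ->
  (wint xmin beta m F <= wint xmin beta m G)%E.
Proof.
elim: m F G => [|m IH] F G FG /=; first by have [] := FG [::] erefl isT.
apply: ge0_le_integral_sup => x; rewrite domE => xD.
  rewrite mule_ge0 ?lee_fin ?dens_ge0 //; apply: wint_ge0 => s sm sx.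
  by have [] // := FG (x :: s); rewrite /= ?sm ?xD.
rewrite lee_wpmul2l ?lee_fin ?dens_ge0 //; apply: IH => s sm sx.
by apply: FG; rewrite /= ?sm ?xD.
Qed.

(** The variance of a sum of independent centred terms, computed by integrating out one weight at a
    time. The offsets [A], [a], [b] absorb the weights already fixed, and the cross terms vanish
    because [g1] and [g2] have mean 0. *)
Lemma wint_quadratic (u g1 g2 : R -> R) (U V1 V2 : R) :
  mean_is u U -> mean_is g1 0 -> mean_is (fun x => g1 x ^+ 2) V1 ->
  mean_is g2 0 -> mean_is (fun x => g2 x ^+ 2) V2 ->
  forall m (A a b : R),
  wint xmin beta m (fun s => (A + \sum_(x <- s) u x + (a + \sum_(x <- s) g1 x) ^+ 2
     + (b + \sum_(x <- s) g2 x) ^+ 2)%:E)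
  = (A + m%:R * U + (a ^+ 2 + m%:R * V1) + (b ^+ 2 + m%:R * V2))%:E.
Proof.
move=> hu h1 h12 h2 h22; elim=> [|m IH] A a b /=.
  by rewrite !big_nil !mul0r !addr0.
(* The part of the integrand that is constant in [x] once the induction hypothesis has been
   applied. *)
pose C := A + m%:R * U + m%:R * V1 + m%:R * V2 + a ^+ 2 + b ^+ 2.
have hC := mean_is_lin C 1 mean_is1 hu.
have ha := mean_is_lin (2 * a) 1 h1 h12.
have hb := mean_is_lin (2 * b) 1 h2 h22.
have hall := mean_is_lin 1 1 (mean_is_lin 1 1 hC ha) hb.
transitivity (\int[mu]_(x in dom) (dens x * (1 * (1 * (C * 1 + 1 * u x)
   + 1 * (2 * a * g1 x + 1 * g1 x ^+ 2)) + 1 * (2 * b * g2 x + 1 * g2 x ^+ 2)))%:E)%E.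
  apply: eq_integral => x _; rewrite EFinM; congr (_ * _)%E.
  have -> : (fun s : seq R => (A + \sum_(y <- x :: s) u y
       + (a + \sum_(y <- x :: s) g1 y) ^+ 2
       + (b + \sum_(y <- x :: s) g2 y) ^+ 2)%:E)
     = (fun s => (A + u x + \sum_(y <- s) u y + (a + g1 x + \sum_(y <- s) g1 y) ^+ 2
     + (b + g2 x + \sum_(y <- s) g2 y) ^+ 2)%:E).
    by apply/funext => s; rewrite !big_cons !addrA.
  by rewrite IH /C; congr EFin; ring.
have [_ ->] := hall; congr EFin; rewrite /C -natr1; ring.
Qed.

End Integrals.

(** * The random graph for fixed weights *)

Definition epr (R : realType) n (w : 'I_n -> R) (e : 'I_n * 'I_n) : R :=
  if (e.1 < e.2)%N then edge_prob w e.1 e.2 else 0.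

(** Since [epr] vanishes on pairs that are not increasing, a set containing such a pair gets a zero
    factor, and the other such pairs contribute the factor 1. *)
Lemma graph_probE (R : realType) n (w : 'I_n -> R) (E : graph n) :
  graph_prob w E = bern (epr w) E.
Proof.
rewrite /graph_prob /bern; case: ifPn => [/forallP h|].
  under [LHS]eq_bigr do rewrite big_mkcond /=.
  rewrite pair_bigA /=; apply: eq_bigr => -[i j] _ /=; rewrite /epr /=.
  case: ifPn => ij; first by [].
  have := h (i, j); rewrite /= (negbTE ij) implybF => /negbTE->.
  by rewrite subr0.
rewrite negb_forall => /existsP[e]; rewrite negb_imply => /andP[eE he].
by apply/esym; rewrite (bigD1 e) //= eE /epr (negbTE he) mul0r.
Qed.

Lemma bern_epr_supp (R : realType) n (w : 'I_n -> R) (E : graph n) :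
  bern (epr w) E != 0 -> forall e, e \in E -> (e.1 < e.2)%N.
Proof.
rewrite -graph_probE /graph_prob; case: ifPn => [/forallP h _ e eE|]; last by rewrite eqxx.
by have := h e; rewrite eE.
Qed.

Section FixedWeights.
Variables (R : realType) (n : nat) (w : 'I_n -> R).
Variables (xmin K kap A s : R).
(** Here [s] is the square root of [n]. [kapE] keeps every pair at a low-weight vertex, and [AE]
    every core pair, at probability at most [1 / 2]; [Ks] separates the core from the low-weight
    vertices, and [xs] makes the lower bound for a leaf-to-core edge at most 1. *)
Hypotheses (n3 : (3 < n)%N) (xmin0 : 0 < xmin) (K0 : 0 < K) (A0 : 0 < A) (s0 : 0 < s).
Hypotheses (sn : n%:R = s ^+ 2) (kapE : 4 * K * kap <= xmin) (AE : 8 * A ^+ 2 <= xmin).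
Hypotheses (Ks : 2 * K < A * s) (xs : xmin * A <= K * s).
Hypotheses (wmin : forall i, xmin <= w i) (wmax : forall i, w i <= kap * n%:R).
Hypotheses (wvol : \sum_i w i <= K * n%:R).
Variable H : {set 'I_n}.
Hypothesis (HE : {in H, forall x, A * s <= w x /\ w x <= 2 * A * s}).

Let p := epr w.
Let W := [set l | w l <= 2 * K].
Let m1 := xmin * A * expR (- (4 * K)) / (4 * K).
Let a := A ^+ 2 / K.

Lemma vol_ge : n%:R * xmin <= \sum_i w i.
Proof.
rewrite -[n in n%:R]card_ord mulr_natl -sumr_const; exact: ler_sum.
Qed.

Lemma vol_gt0 : 0 < \sum_i w i.
Proof.
apply: lt_le_trans vol_ge; rewrite mulr_gt0 // ltr0n; exact: leq_trans n3.
Qed.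

Lemma w_gt0 i : 0 < w i. Proof. exact: lt_le_trans (wmin i). Qed.

Lemma edge_prob01 i j : 0 <= edge_prob w i j <= 1.
Proof.
rewrite /edge_prob le_min ge_min lexx orbT ler01 !andbT.
by rewrite !mulr_ge0 ?invr_ge0 ?(ltW vol_gt0) ?(ltW (w_gt0 _)).
Qed.

Lemma epr01 e : 0 <= p e <= 1.
Proof. by rewrite /p /epr; case: ifP => _; rewrite ?edge_prob01 // lexx ler01. Qed.

Lemma epr_opair x y : x != y -> p (opair x y) = edge_prob w x y.
Proof.
rewrite -val_eqE /= neq_ltn /p /epr /opair => /orP[xy|yx]; first by rewrite xy /= xy.
have -> : (x < y)%N = false by rewrite ltnNge ltnW.
by rewrite /= yx /edge_prob [w y * _]mulrC.
Qed.

Lemma edge_prob_le i j : edge_prob w i j <= w i * w j / \sum_k w k.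
Proof. by rewrite /edge_prob ge_min lexx. Qed.

Lemma edge_prob_le_num i j c : w i * w j <= c * (n%:R * xmin) -> edge_prob w i j <= c.
Proof.
move=> h; apply: le_trans (edge_prob_le i j) _.
have v0 := vol_gt0; have v1 := vol_ge.
have ww : 0 < w i * w j by rewrite mulr_gt0 ?w_gt0.
have nx : 0 < n%:R * xmin by rewrite mulr_gt0 // ltr0n; exact: leq_trans n3.
have c0 : 0 < c by rewrite -(pmulr_lgt0 _ nx) (lt_le_trans ww).
by rewrite ler_pdivrMr //; apply: le_trans h _; rewrite ler_pM2l.
Qed.

Lemma edge_prob_ge_num i j c : c <= 1 -> c * (K * n%:R) <= w i * w j ->
  0 <= c -> c <= edge_prob w i j.
Proof.
move=> c1 h c0; rewrite /edge_prob le_min c1 andbT ler_pdivlMr ?vol_gt0 //.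
by apply: le_trans h; rewrite ler_wpM2l.
Qed.

(** With total weight between [n * xmin] and [K * n], the weights in [H] give at most
    [4 * A ^+ 2 / xmin] and at least [A ^+ 2 / K]. The latter is at most 1 because [xmin <= K], so
    the minimum in [edge_prob] does not cut it. *)
Lemma core_pairs_epr : {in core_pairs H, forall e, a <= p e /\ p e <= 1 / 2}.
Proof.
have AE' := AE; have xmin0' := xmin0; have K0' := K0.
move=> [x y]; rewrite inE /= => /and3P[xy xH yH].
have [x1 x2] := HE xH; have [y1 y2] := HE yH.
have As : 0 < A * s by rewrite mulr_gt0.
have ple : p (x, y) <= 1 / 2.
  rewrite /p /epr xy /=; apply: edge_prob_le_num; rewrite sn.
  apply: le_trans (_ : (2 * A * s) * (2 * A * s) <= _).
    by apply: ler_pM => //; exact/ltW/w_gt0.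
  have -> : 2 * A * s * (2 * A * s) = 1 / 2 * (s ^+ 2 * (8 * A ^+ 2)) by field.
  by rewrite !ler_wpM2l //; nra.
have lew : A ^+ 2 / K * (K * n%:R) <= w x * w y.
  rewrite sn; have -> : A ^+ 2 / K * (K * s ^+ 2) = (A * s) * (A * s).
    by field; rewrite gt_eqF.
  by apply: ler_pM => //; exact: ltW.
split => //; rewrite /p /epr xy /=; apply: edge_prob_ge_num => //; last first.
  by rewrite mulr_ge0 ?invr_ge0 ?sqr_ge0 ?(ltW K0).
have := le_trans lew (ler_pM (ltW (w_gt0 _)) (ltW (w_gt0 _)) x2 y2).
have := wvol; have := vol_ge => v1 v2.
have xK : xmin <= K by have := le_trans v1 v2; rewrite mulrC ler_pM2r // sn exprn_gt0.
by move=> _; rewrite ler_pdivrMr // mul1r; nra.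
Qed.

(** Markov's inequality: more than [n / 2] weights above [2 * K] would exceed the total weight. *)
Lemma card_low_weight : n%:R / 2 <= #|W|%:R :> R.
Proof.
have h : (n%:R - #|W|%:R) * (2 * K) <= K * n%:R.
  apply: le_trans wvol.
  have -> : n%:R - #|W|%:R = #|~: W|%:R :> R.
    by rewrite -[n in n%:R]card_ord -(finset.cardsC W) natrD; ring.
  rewrite mulrC mulr_natr -sumr_const big_mkcond; apply: ler_sum => i _.
  rewrite !inE; have [_|h] := leP (w i) (2 * K); first exact/ltW/w_gt0.
  exact: ltW.
have K0' := K0; nra.
Qed.

(** A vertex of [W] is joined to [x] with probability at least [xmin * A / (K * s)] and to nothing
    else with probability at least [expR (- (4 * K))], as its expected degree is at most [2 * K].
    Over [n / 2] vertices the mean is at least [2 * (m1 * s)]. The correlation slack is twice the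
    largest probability of a pair inside [W]. *)
Lemma leaf_count_prob x : x \in H ->
  bprob p (fun E => #|[set l in W | leaf_event l x E]|%:R < m1 * s)
    <= 2 / (m1 * s) + 32 * K ^+ 2 / (xmin * s ^+ 2).
Proof.
move=> xH; have [x1 x2] := HE xH.
have n0 : 0 < n%:R :> R by rewrite ltr0n; exact: leq_trans n3.
have m10 : 0 < m1 by rewrite !mulr_gt0 ?invr_gt0 ?expR_gt0 ?mulr_gt0.
have lx l : l \in W -> l != x.
  by rewrite inE => lW; apply: contraTneq lW => ->; rewrite -ltNge (lt_le_trans Ks).
have half l y : l \in W -> edge_prob w l y <= 1 / 2.
  rewrite inE => lW; apply: edge_prob_le_num.
  apply: le_trans (_ : (2 * K) * (kap * n%:R) <= _).
    by apply: ler_pM => //; exact/ltW/w_gt0.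
  have -> : 2 * K * (kap * n%:R) = 1 / 2 * (n%:R * (4 * K * kap)) by field.
  by rewrite !ler_wpM2l.
have Pge l : l \in W -> xmin * A / (K * s) * expR (- (4 * K)) <= bprob p (leaf_event l x).
  move=> lW; apply: le_trans (leaf_prob_ge epr01 (lx _ lW) _); last first.
    by move=> y yl; rewrite epr_opair 1?eq_sym // half.
  apply: ler_pM; rewrite ?expR_ge0 //.
  - by rewrite !mulr_ge0 ?invr_ge0 ?mulr_ge0 ?ltW.
  - rewrite epr_opair ?lx //; apply: edge_prob_ge_num.
    + by rewrite ler_pdivrMr ?mulr_gt0 // mul1r.
    + have -> : xmin * A / (K * s) * (K * n%:R) = xmin * (A * s).
        by rewrite sn; field; rewrite !gt_eqF.
      by apply: ler_pM => //; [exact: ltW|rewrite ltW // mulr_gt0].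
    + by rewrite !mulr_ge0 ?invr_ge0 ?mulr_ge0 ?ltW.
  - rewrite ler_expR mulNr lerN2.
    have : \sum_(y | y != l) p (opair l y) <= w l.
      apply: (@le_trans _ _ (\sum_(y | y != l) w l * w y / \sum_k w k)).
        by apply: ler_sum => y yl; rewrite epr_opair 1?eq_sym //; exact: edge_prob_le.
      rewrite -mulr_suml -mulr_sumr ler_pdivrMr ?vol_gt0 // ler_pM2l ?w_gt0 //.
      rewrite [leRHS](bigD1 l) //= lerDr; exact/ltW/w_gt0.
    by move: lW; rewrite inE; lra.
have := second_moment epr01 (W := W) (A := fun l => leaf_event l x)
  (M := 2 * (m1 * s)) (r := 8 * K ^+ 2 / (xmin * s ^+ 2)).
have -> : 2 * (m1 * s) / 2 = m1 * s by field.
have -> : 4 / (2 * (m1 * s)) + 4 * (8 * K ^+ 2 / (xmin * s ^+ 2))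
  = 2 / (m1 * s) + 32 * K ^+ 2 / (xmin * s ^+ 2) by field; rewrite !gt_eqF.
apply.
- by rewrite !mulr_ge0 ?invr_ge0 ?mulr_ge0 ?sqr_ge0 ?ltW.
- by apply: mulr_gt0 => //; apply: mulr_gt0.
- apply: le_trans (_ : \sum_(l in W) (xmin * A / (K * s) * expR (- (4 * K))) <= _);
    last exact: ler_sum.
  rewrite sumr_const -[leRHS]mulr_natl.
  have := card_low_weight; rewrite sn.
  have -> : 2 * (m1 * s) = s ^+ 2 / 2 * (xmin * A / (K * s) * expR (- (4 * K))).
    by rewrite /m1; field; rewrite !gt_eqF.
  by move=> ?; rewrite ler_pM2r // !mulr_gt0 ?invr_gt0 ?mulr_gt0 ?expR_gt0.
move=> l l' lW lW' ll.
have := leaf_prob_pair epr01 ll (lx _ lW) (lx _ lW').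
have := half l l' lW; rewrite epr_opair //.
have : edge_prob w l l' <= 4 * K ^+ 2 / (xmin * s ^+ 2).
  apply: edge_prob_le_num.
  have -> : 4 * K ^+ 2 / (xmin * s ^+ 2) * (n%:R * xmin) = (2 * K) * (2 * K).
    by rewrite sn; field; rewrite !gt_eqF.
  by move: lW lW'; rewrite !inE => ? ?; apply: ler_pM => //; exact/ltW/w_gt0.
have /andP[+ _] := edge_prob01 l l'.
have := bprob_ge0 epr01 (fun E => leaf_event l x E && leaf_event l' x E).
have := bprob_ge0 epr01 (leaf_event l x); have := bprob_ge0 epr01 (leaf_event l' x).
have -> : 8 * K ^+ 2 / (xmin * s ^+ 2) = 2 * (4 * K ^+ 2 / (xmin * s ^+ 2)) by ring.
move: (4 * K ^+ 2 / _) (edge_prob _ _ _) (bprob _ (fun E => _ && _))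
  (bprob _ (leaf_event l x)) (bprob _ (leaf_event l' x)) => t q B P P'.
move=> P'0 P0 B0 q0 qt q2 h.
have PP : 0 <= P * P' by rewrite mulr_ge0.
apply: le_trans (_ : (1 + 2 * q) * (P * P') <= _); last by rewrite ler_wpM2r //; lra.
apply: le_trans (_ : (1 + 2 * q) * (B * (1 - q)) <= _); last by rewrite ler_wpM2l //; lra.
(* For [q <= 1 / 2] the factor [1 + 2 * q] makes up for the division by [1 - q]. *)
have -> : (1 + 2 * q) * (B * (1 - q)) = B + B * (q * (1 - 2 * q)) by ring.
by rewrite lerDl !mulr_ge0 //; lra.
Qed.


Let few_leaves E := [exists x in H, #|[set l in W | leaf_event l x E]|%:R < m1 * s].

Lemma few_leaves_prob : bprob p few_leaves <=
  #|H|%:R * (2 / (m1 * s) + 32 * K ^+ 2 / (xmin * s ^+ 2)).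
Proof.
apply: le_trans (bprob_exists epr01 _ _) _.
rewrite [leRHS]mulr_natl -sumr_const; apply: ler_sum => x; exact: leaf_count_prob.
Qed.

Lemma many_leavesP E : bern p E != 0 -> ~~ few_leaves E ->
  [/\ forall x, x \in H -> x \in W -> False,
      forall x, [set l in W | leaf_event l x E] \subset W,
      {in H, forall x l, l \in [set l in W | leaf_event l x E] -> is_leaf E l x} &
      {in H, forall x, m1 * s <= #|[set l in W | leaf_event l x E]|%:R}].
Proof.
move=> Ep nf.
have HW x : x \in H -> x \in W -> False.
  move=> xH; rewrite inE; have [x1 _] := HE xH.
  by rewrite leNgt (lt_le_trans Ks x1).
split => //.
- by move=> x; apply/fintype.subsetP => l; rewrite inE => /andP[].
- move=> x xH l; rewrite inE => /andP[lW]; apply: leaf_eventP.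
    exact: bern_epr_supp Ep.
  by apply: contraTneq lW => ->; apply/negP; exact: HW.
- move=> x xH; move: nf; rewrite negb_exists => /forallP/(_ x).
  by rewrite xH -leNgt.
Qed.

Let m1s0 : 0 < m1 * s.
Proof. by rewrite /m1 !mulr_gt0 ?invr_gt0 ?expR_gt0 ?mulr_gt0. Qed.

Lemma labels_prob (D : seq bool -> seq bool -> option nat) (S : R) :
  bprob p (fun E => `[< exists L : 'I_n -> seq bool,
     (forall x y, D (L x) (L y) = gdist E x y) /\ (\sum_v size (L v))%:R < S >])
  <= #|H|%:R * (2 / (m1 * s) + 32 * K ^+ 2 / (xmin * s ^+ 2))
     + 2 ^+ (2 * Num.truncn (S / (m1 * s)) + #|H|) * (1 - a) ^+ #|core_pairs H|.
Proof.
set Q := fun E => _.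
apply: le_trans (_ : bprob p (fun E => few_leaves E || (~~ few_leaves E && Q E)) <= _).
  by apply: le_bprob => [|E _ ->]; [exact: epr01|case: (few_leaves E)].
apply: le_trans (bprobU epr01 _ _) _; apply: lerD; first exact: few_leaves_prob.
(* From [a <= p e <= 1 / 2], both [p e] and its complement are at most [1 - a]. *)
apply: (@core_labels_prob n R p epr01 H _ _ _ D) => [e /core_pairs_epr[? ?]|E Ep].
  by split; lra.
move=> /andP[/(many_leavesP Ep)[HW FW Fl hm] /asboolP[L [DL SL]]].
have [g [gS gE]] := labels_decode_core n3 HW FW Fl m1s0 hm DL.
exists g.
  rewrite truncn_ge_nat; last first.
    by rewrite divr_ge0 ?(ltW m1s0) // (le_trans _ (ltW SL)).
  by rewrite ler_pdivlMr // mulrC (le_trans gS) // ltW.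
move=> x y xH yH xy; have xy' : x != y by rewrite -val_eqE /= neq_ltn xy.
rewrite -gE // /adj.
case: ((y, x) \in E) (bern_epr_supp Ep (e := (y, x))) => [/(_ isT)/=|_]; last by rewrite orbF.
by rewrite ltnNge ltnW.
Qed.

(** When leaves are plentiful, a cover smaller than [S] leaves fewer core edges than half of the
    lower bound [a * #|core_pairs H|] for their mean, which [core_edges_prob] makes unlikely. *)
Lemma two_hop_prob (S : R) : (1 < #|H|)%N -> S <= m1 * s * (a * #|core_pairs H|%:R / 2) ->
  bprob p (fun E => `[< exists L : 'I_n -> {set 'I_n},
     two_hop_cover E L /\ (\sum_v #|L v|)%:R < S >])
  <= #|H|%:R * (2 / (m1 * s) + 32 * K ^+ 2 / (xmin * s ^+ 2))
     + 4 / (a * #|core_pairs H|%:R).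
Proof.
move=> H1 hS; set Q := fun E => _.
apply: le_trans (_ : bprob p (fun E => few_leaves E || (~~ few_leaves E && Q E)) <= _).
  by apply: le_bprob => [|E _ ->]; [exact: epr01|case: (few_leaves E)].
apply: le_trans (bprobU epr01 _ _) _; apply: lerD; first exact: few_leaves_prob.
have a0 : 0 < a by rewrite divr_gt0 // exprn_gt0.
apply: le_trans (core_edges_prob epr01 a0 H1 _); last by move=> e /core_pairs_epr[].
apply: le_bprob => [|E Ep]; first exact: epr01.
move=> /andP[/(many_leavesP Ep)[HW FW Fl hm] /asboolP[L [DL SL]]].
have := two_hop_core_edges n3 (bern_epr_supp Ep) HW FW Fl m1s0 hm DL => h.
by rewrite -(ltr_pM2l m1s0) (le_lt_trans h) // (lt_le_trans SL).
Qed.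

End FixedWeights.

(** * Error bounds for good weight vectors *)

Lemma subset_of_card (T : finType) (B : {set T}) k : (k <= #|B|)%N ->
  exists2 C : {set T}, {subset C <= B} & #|C| = k.
Proof.
move=> kB; exists [set x in take k (enum B)].
  by move=> x; rewrite inE => /mem_take; rewrite mem_enum.
rewrite cardsE (card_uniqP _) ?take_uniq ?enum_uniq // size_take -cardE.
by case: ltngtP kB.
Qed.

Section GoodWeights.
Variables (R : realType) (xmin K A tau : R).
Hypotheses (xmin0 : 0 < xmin) (K0 : 0 < K) (A0 : 0 < A) (tau0 : 0 < tau).
Hypothesis (AE : 8 * A ^+ 2 <= xmin).

Definition good_weights n (u s : R) (w : 'I_n -> R) :=
  [/\ forall i, xmin <= w i, forall i, w i <= xmin / (4 * K) * n%:R,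
      \sum_i w i <= K * n%:R &
      tau * u <= #|[set i | A * s <= w i <= 2 * A * s]|%:R].

(** In the application [u] is [n^((1-eps)/2)] and [v] is [n^(eps/2)], so that [u * v] is [sqrt n]
    and [u * v * u ^+ 2] is [n^(3/2-eps)]. All estimates then become polynomial in [u] and [v]. *)
Lemma good_weights_bound : exists c : R, 0 < c /\
  forall delta : R, 0 < delta -> exists M : R, 1 <= M /\
  forall (n : nat) (u v : R) (w : 'I_n -> R), M <= u -> M <= v ->
    n%:R = (u * v) ^+ 2 -> good_weights u (u * v) w ->
  (forall D : seq bool -> seq bool -> option nat,
    bprob (epr w) (fun E => `[< exists L : 'I_n -> seq bool,
     (forall x y, D (L x) (L y) = gdist E x y) /\
      (\sum_v size (L v))%:R < c * (u * v * u ^+ 2) >]) <= delta) /\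
  bprob (epr w) (fun E => `[< exists L : 'I_n -> {set 'I_n},
     two_hop_cover E L /\ (\sum_v #|L v|)%:R < c * (u * v * u ^+ 2) >]) <= delta.
Proof.
have [xmin0' K0' A0' tau0'] : [/\ 0 < xmin, 0 < K, 0 < A & 0 < tau] by [].
have [m1 m1E] : exists m1, m1 = xmin * A * expR (- (4 * K)) / (4 * K) by eexists.
have [a aE] : exists a, a = A ^+ 2 / K by eexists.
have m10 : 0 < m1 by rewrite m1E !mulr_gt0 ?invr_gt0 ?expR_gt0 ?mulr_gt0.
have a0 : 0 < a by rewrite aE divr_gt0 // exprn_gt0.
(* The code then has at most [a * tau ^+ 2 * u ^+ 2 / 32 + h] bits, against an exponent of at least
   [a * tau ^+ 2 * u ^+ 2 / 16] from the core pairs. *)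
pose c := m1 * a * tau ^+ 2 / 64.
have c0 : 0 < c by rewrite divr_gt0 ?mulr_gt0 ?exprn_gt0.
exists c; split => //.
move=> delta delta0.
pose C1 := 2 * tau / m1 + 32 * tau * K ^+ 2 / xmin.
have C10 : 0 < C1 by rewrite addr_gt0 // !mulr_gt0 ?invr_gt0 ?exprn_gt0.
(* Each threshold secures one of the inequalities below, in order from [Ks] to [e7]; taking their
   sum as [M] secures all of them. *)
pose t1 := (2 * K + 1) / A; pose t2 := xmin * A / K; pose t3 := 4 / tau.
pose t4 := 64 / (a * tau); pose t5 := 2 * C1 / delta; pose t6 := 2 / (tau * delta).
pose t7 := 128 / (a * tau ^+ 2 * delta).
have [p1 p2 p3 p4] : [/\ 0 < t1, 0 < t2, 0 < t3 & 0 < t4].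
  by split; rewrite ?divr_gt0 ?addr_gt0 ?mulr_gt0.
have [p5 p6 p7] : [/\ 0 < t5, 0 < t6 & 0 < t7].
  by split; rewrite ?divr_gt0 ?mulr_gt0 ?exprn_gt0.
exists (2 + t1 + t2 + t3 + t4 + t5 + t6 + t7); split; first lra.
move=> n u v w hu hv nE [w1 w2 w3 w4]; set s := u * v in nE w4 *.
have u2 : 2 <= u by lra.
have v2 : 2 <= v by lra.
have [u0 v0] : 0 < u /\ 0 < v by split; lra.
have us : u <= s by rewrite /s; nra.
have s0 : 0 < s by lra.
have s1 : 1 <= s by lra.
have n3 : (3 < n)%N by rewrite -(ltr_nat R) nE; nra.
have kapE : 4 * K * (xmin / (4 * K)) <= xmin by rewrite mulrC divfK // gt_eqF // mulr_gt0.
have Ks : 2 * K < A * s.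
  have : t1 <= s by lra.
  by rewrite /t1 ler_pdivrMr //; lra.
have xs : xmin * A <= K * s.
  have : t2 <= s by lra.
  by rewrite /t2 ler_pdivrMr //; lra.
have tu4 : 4 <= tau * u.
  have : t3 <= u by lra.
  by rewrite /t3 ler_pdivrMr //; lra.
have tu64 : 64 <= a * tau * u.
  have : t4 <= u by lra.
  by rewrite /t4 ler_pdivrMr ?mulr_gt0 //; lra.
have e5 : C1 / v <= delta / 2.
  have : t5 <= v by lra.
  rewrite /t5 ler_pdivrMr // => h; rewrite ler_pdivrMr //; lra.
have e6 : 1 / (tau * u) <= delta / 2.
  have : t6 <= u by lra.
  rewrite /t6 ler_pdivrMr ?mulr_gt0 // => h; rewrite ler_pdivrMr ?mulr_gt0 //.
  lra.
have e7 : 64 / (a * (tau ^+ 2 * u)) <= delta / 2.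
  have : t7 <= u by lra.
  rewrite /t7 ler_pdivrMr ?mulr_gt0 ?exprn_gt0 // => h.
  rewrite ler_pdivrMr ?mulr_gt0 ?exprn_gt0 //.
  lra.
have tu0 : 0 <= tau * u by lra.
have [H HB cH] : exists2 H : {set 'I_n},
    {subset H <= [set i | A * s <= w i <= 2 * A * s]} & #|H| = Num.truncn (tau * u).
  apply: subset_of_card; rewrite -(ler_nat R); apply: le_trans w4.
  by rewrite truncn_le.
have HE : {in H, forall x, A * s <= w x /\ w x <= 2 * A * s}.
  by move=> x /HB; rewrite inE => /andP[].
set h : R := #|H|%:R.
have h1 : h <= tau * u by rewrite /h cH truncn_le.
have h2 : tau * u < h + 1 by rewrite /h cH natr1 truncnS_gt.
have H1 : (1 < #|H|)%N by rewrite -(ltr_nat R) -/h; lra.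
set k : R := #|core_pairs H|%:R.
have kE : 2 * k + h = h * h.
  have := congr1 (fun j => j%:R : R) (card_core_pairs H).
  by rewrite natrD !natrM.
(* Here [k] is [h * (h - 1) / 2], and [h - 1 > tau * u - 2 >= tau * u / 2]. *)
have kge : tau ^+ 2 * u ^+ 2 / 16 <= k by rewrite -exprMn; nra.
have k0 : 0 < k by apply: lt_le_trans kge; rewrite divr_gt0 ?mulr_gt0 ?exprn_gt0.
(* One factor [s] of the square is dropped, as [s >= 1]; then [h <= tau * u] against [s = u * v]
   leaves a multiple of [1 / v]. *)
have leaves : h * (2 / (m1 * s) + 32 * K ^+ 2 / (xmin * s ^+ 2)) <= delta / 2.
  apply: le_trans e5.
  have -> : C1 / v = tau * u * (2 / (m1 * s) + 32 * K ^+ 2 / (xmin * s)).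
    by rewrite /C1 /s; field; rewrite !gt_eqF.
  apply: ler_pM => //.
    by rewrite ltW // addr_gt0 // !mulr_gt0 ?invr_gt0 ?mulr_gt0 ?exprn_gt0.
  rewrite lerD2l ler_pM2l ?mulr_gt0 ?exprn_gt0 //.
  rewrite lef_pV2 ?posrE ?mulr_gt0 ?exprn_gt0 // ler_pM2l // expr2; nra.
split.
  move=> D; apply: le_trans (labels_prob n3 xmin0 K0 A0 s0 nE kapE AE Ks xs w1 w2 w3 HE D _) _.
  rewrite -m1E -aE (splitr delta); apply: lerD; first exact: leaves.
  apply: le_trans e6.
  have a12 : a <= 1.
    have /card_gt0P[e /(core_pairs_epr n3 xmin0 K0 A0 s0 nE AE w1 w3 HE)[+ +]] :
      (0 < #|core_pairs H|)%N by rewrite -(ltr_nat R).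
    by rewrite -aE; lra.
  set N := (2 * _ + _)%N.
  have Nle : N%:R <= 2 * (c * u ^+ 2 / m1) + h.
    rewrite /N natrD natrM lerD2r ler_pM2l //.
    apply: le_trans (_ : c * (s * u ^+ 2) / (m1 * s) <= _).
      rewrite truncn_le //; apply: divr_ge0; apply: ltW;
      by rewrite ?mulr_gt0 ?exprn_gt0.
    rewrite le_eqVlt; apply/orP; left; apply/eqP.
    by field; rewrite !gt_eqF.
  (* Both factors are compared with exponentials, by [2 <= expR 1] and [1 - a <= expR (- a)]. *)
  apply: le_trans (_ : expR (N%:R - a * k) <= _).
    rewrite expRD; apply: ler_pM.
    - by rewrite exprn_ge0.
    - by rewrite exprn_ge0 // subr_ge0.
    - rewrite -[N%:R]mulr1 expRM_natl; apply: lerXn2r; rewrite ?nnegrE ?expR_ge0 //.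
      by apply: le_trans (expR_ge1Dx 1); lra.
    - rewrite -mulNr mulrC expRM_natl; apply: lerXn2r; rewrite ?nnegrE ?expR_ge0 ?subr_ge0 //.
      by apply: le_trans (expR_ge1Dx (- a)).
  apply: le_trans (_ : expR (- (tau * u)) <= _).
    rewrite ler_expR.
    have : c * u ^+ 2 / m1 = a * (tau ^+ 2 * u ^+ 2) / 64.
      by rewrite /c; field; rewrite !gt_eqF.
    have : 64 * (tau * u) <= a * (tau ^+ 2 * u ^+ 2).
      by have := ler_wpM2r tu0 tu64; lra.
    have : a * (tau ^+ 2 * u ^+ 2 / 16) <= a * k by rewrite ler_pM2l.
    rewrite mulrA; lra.
  rewrite expRN -[leLHS]mul1r ler_pM2l // lef_pV2 ?posrE ?expR_gt0 //; last lra.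
  by apply: le_trans (expR_ge1Dx _); lra.
apply: le_trans (two_hop_prob n3 xmin0 K0 A0 s0 nE kapE AE Ks xs w1 w2 w3 HE H1 _) _.
  rewrite -m1E -aE -/k.
  have -> : c * (s * u ^+ 2) = m1 * s * (a * (tau ^+ 2 * u ^+ 2 / 16) / 4).
    by rewrite /c; field.
  rewrite ler_pM2l ?mulr_gt0 //.
  have : a * (tau ^+ 2 * u ^+ 2 / 16) <= a * k by rewrite ler_pM2l.
  have : 0 < a * k by rewrite mulr_gt0.
  lra.
rewrite -m1E -aE (splitr delta); apply: lerD; first exact: leaves.
apply: le_trans e7; rewrite -/k.
rewrite ler_pdivrMr ?mulr_gt0 // mulrAC ler_pdivlMr ?mulr_gt0 ?exprn_gt0 //.
have : a * (tau ^+ 2 * u ^+ 2 / 16) <= a * k by rewrite ler_pM2l.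
have : a * (tau ^+ 2 * u) * 1 <= a * (tau ^+ 2 * u) * u.
  by rewrite ler_pM2l ?mulr_gt0 ?exprn_gt0 //; lra.
lra.
Qed.

End GoodWeights.

(** * Concentration of the weights *)

Section WeightConcentration.
Variables (R : realType) (xmin eps : R).
Hypotheses (xmin0 : 0 < xmin) (eps0 : 0 < eps) (eps1 : eps < 1).
Notation beta := (2 + eps).
Notation mean := (mean_is xmin beta).

Let beta1 : 1 < beta. Proof. have e0 := eps0; lra. Qed.

Lemma big_seq_ord (f : R -> R) (n : nat) (s : seq R) : size s = n ->
  \sum_(x <- s) f x = \sum_(i < n) f (nth 0 s i).
Proof. by move=> <-; rewrite (big_nth 0) big_mkord. Qed.

(** Below [B], the square of [t] is at most [B^(1-eps/2)] times [t^(1+eps/2)], and this last power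
    has a finite mean because its exponent is below [beta - 1]. *)
Lemma mean_truncated_square (B m1 : R) : xmin <= B ->
  mean (fun t => t `^ (1 + eps / 2)) m1 ->
  exists2 v, mean (fun t => (t `^ 1 - (B <= t)%R%:R * t `^ 1) ^+ 2) v &
    v <= B `^ (1 - eps / 2) * m1.
Proof.
move=> xB hm; have e0 := eps0; have e1 := eps1; have x0 := xmin0.
have B0 : 0 < B by lra.
have hB := mean_is_lin (B `^ (1 - eps / 2)) 0 hm hm.
rewrite mul0r addr0 in hB.
have hle t : xmin <= t -> (t `^ 1 - (B <= t)%R%:R * t `^ 1) ^+ 2 <=
    B `^ (1 - eps / 2) * t `^ (1 + eps / 2) + 0 * t `^ (1 + eps / 2).
  move=> xt; have t0 : 0 < t by lra.
  rewrite mul0r addr0; case: (leP B t) => Bt.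
    by rewrite mul1r subrr expr0n mulr_ge0 ?powR_ge0.
  rewrite mul0r subr0 powRr1 ?(ltW t0) //.
  have -> : t ^+ 2 = t `^ (1 - eps / 2) * t `^ (1 + eps / 2).
    rewrite -powRD; last by apply/implyP => _; rewrite gt_eqF.
    rewrite -powR_mulrn ?(ltW t0) //; by congr (_ `^ _); field.
  rewrite ler_wpM2r ?powR_ge0 // ge0_ler_powR ?nnegrE ?(ltW t0) ?(ltW B0) ?(ltW Bt) //.
  lra.
have [] := mean_is_dominated _ hB (phi := fun t => (t `^ 1 - (B <= t)%R%:R * t `^ 1) ^+ 2).
- apply: measurable_funX; apply: measurable_funB; first exact: measurable_powR.
  apply: measurable_funM; last exact: measurable_powR.
  have -> : (fun t : R => (B <= t)%R%:R : R) = (fun t => if B <= t then 1 else 0).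
    by apply/funext => t; case: ifP.
  by apply: measurable_fun_ifT => //; exact: measurable_fun_ler.
- by move=> t xt; rewrite ger0_norm ?sqr_ge0 // hle.
move=> v hv; exists v => //; exact: (mean_is_le beta1 hv hB).
Qed.

Lemma mean_is_centered (phi : R -> R) (m Q al : R) :
  mean phi m -> mean (fun t => phi t ^+ 2) Q ->
  mean (fun t => al * (phi t - m)) 0 /\
  mean (fun t => (al * (phi t - m)) ^+ 2) (al ^+ 2 * (Q - m ^+ 2)).
Proof.
move=> h h2; have one := mean_is1 xmin0 beta1; split.
  by apply: (eq_mean_is (mean_is_lin al (- al * m) h one)) => [t _|]; ring.
apply: (eq_mean_is (mean_is_lin (al ^+ 2) 1 h2
  (mean_is_lin (- 2 * al ^+ 2 * m) (al ^+ 2 * m ^+ 2) h one))) => [t _|]; ring.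
Qed.

Definition trunc_id (B t : R) : R := t `^ 1 - (B <= t)%R%:R * t `^ 1.
(** For [a <= b] this is the indicator of a half-open interval, written as a difference of tails so
    that its mean comes from [mean_is_tail]. *)
Definition in_window (a b t : R) : R := (a <= t)%R%:R - (b <= t)%R%:R.

Lemma in_window_sqr a b t : a <= b -> in_window a b t ^+ 2 = in_window a b t.
Proof.
move=> ab; rewrite /in_window; case: (leP a t) => h1; case: (leP b t) => h2;
  rewrite /= ?subrr ?subr0 ?expr0n ?expr1n //.
by exfalso; lra.
Qed.

(** Each failure makes one summand at least 1. A weight reaching [B] shows in the first sum.
    Otherwise truncation changes nothing, and an excessive volume is a normalised deviation of at
    least 1; a sparse window is one of at most -1. *)
Lemma bad_weights_cost n (t : seq R) (B nu mq rho a b : R) :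
  size t = n -> (0 < n)%N -> all (<=%R xmin) t -> 0 < nu -> mq <= nu ->
  0 < rho -> a <= b ->
  ~ [/\ forall i : 'I_n, nth 0 t i <= B,
        \sum_(i < n) nth 0 t i <= 2 * nu * n%:R &
        n%:R * rho / 2 <= #|[set i : 'I_n | a <= nth 0 t i <= b]|%:R] ->
  1 <= \sum_(x <- t) (B <= x)%R%:R
       + (\sum_(x <- t) (nu * n%:R)^-1 * (trunc_id B x - mq)) ^+ 2
       + (\sum_(x <- t) 2 / (n%:R * rho) * (in_window a b x - rho)) ^+ 2.
Proof.
move=> tn n0 tx nu0 mqnu rho0 ab bad.
set SU := \sum_(x <- t) _; set S1 := \sum_(x <- t) _; set S2 := \sum_(x <- t) _.
have SU0 : 0 <= SU by apply: sumr_ge0.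
have q1 := sqr_ge0 S1; have q2 := sqr_ge0 S2.
have nR0 : 0 < n%:R :> R by rewrite ltr0n.
have x0 := xmin0.
have wmin (i : 'I_n) : xmin <= nth 0 t i.
  by move/allP: tx; apply; rewrite mem_nth // tn.
have [hmax|] := boolP (all (fun x => x < B) t); last first.
  rewrite -has_predC => /hasP[x xt /=]; rewrite -leNgt => Bx.
  suff : 1 <= SU by lra.
  by rewrite /SU (big_rem x) //= Bx lerDl sumr_ge0.
have wmax (i : 'I_n) : nth 0 t i < B.
  by move/allP: hmax; apply; rewrite mem_nth // tn.
have centre (f : R -> R) c d : \sum_(x <- t) d * (f x - c)
    = d * (\sum_(i < n) f (nth 0 t i) - n%:R * c).
  by rewrite (big_seq_ord _ tn) -mulr_sumr sumrB sumr_const card_ord mulr_natl.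
have [hvol|hvol] := leP (\sum_(i < n) nth 0 t i) (2 * nu * n%:R); last first.
  suff h : 1 <= S1.
    have : 1 <= S1 ^+ 2 by rewrite expr_ge1 // (le_trans ler01 h).
    by lra.
  rewrite /S1 centre.
  have -> : \sum_(i < n) trunc_id B (nth 0 t i) = \sum_(i < n) nth 0 t i.
    apply: eq_bigr => i _; rewrite /trunc_id leNgt wmax /= mul0r subr0 powRr1 //.
    exact: ltW (lt_le_trans x0 (wmin i)).
  rewrite mulrC ler_pdivlMr ?mulr_gt0 // mul1r.
  have : n%:R * mq <= n%:R * nu by rewrite ler_pM2l.
  by lra.
have [hc|hc] := leP (n%:R * rho / 2) #|[set i : 'I_n | a <= nth 0 t i <= b]|%:R.
  by exfalso; apply: bad; split => // i; exact: ltW.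
suff h : 1 <= - S2.
  have : 1 <= (- S2) ^+ 2 by rewrite expr_ge1 // (le_trans ler01 h).
  by rewrite sqrrN; lra.
rewrite /S2 centre.
have : \sum_(i < n) in_window a b (nth 0 t i)
    <= #|[set i : 'I_n | a <= nth 0 t i <= b]|%:R.
  rewrite -sum1_card natr_sum [leRHS]big_mkcond; apply: ler_sum => i _.
  rewrite inE /in_window; case: (leP a) => h1; case: (leP (nth 0 t i) b) => h2;
    case: (leP b) => h3 /=; lra.
move=> h; rewrite -mulrN mulrAC ler_pdivlMr ?mulr_gt0 //.
by lra.
Qed.

(** The expected number of weights above the cap, which is of order [n^(-eps)] for [n = s ^+ 2]. *)
Lemma powR_tail_count (s K : R) : 0 < s -> 0 < K ->
  s ^+ 2 * (xmin / (4 * K) * s ^+ 2 / xmin) `^ (1 - beta)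
  = (4 * K) `^ (1 + eps) / (s `^ eps) ^+ 2.
Proof.
move=> s0 K0; have x0 := xmin0.
have -> : xmin / (4 * K) * s ^+ 2 / xmin = (4 * K)^-1 * s ^+ 2.
  by field; rewrite !gt_eqF.
rewrite [(_^-1 * _) `^ _]powRM ?invr_ge0 ?sqr_ge0 ?mulr_ge0 ?(ltW K0) //.
rewrite -[(4 * K)^-1]powR_inv1 ?mulr_ge0 ?(ltW K0) // -powRrM.
have -> : -1 * (1 - beta) = 1 + eps by ring.
rewrite mulrCA; congr (_ * _); rewrite -powR_mulrn ?(ltW s0) // -powRrM.
rewrite -powRD; last by apply/implyP => _; rewrite gt_eqF.
rewrite -powR_mulrn ?powR_ge0 // -powRrM -powRN; congr (_ `^ _); ring.
Qed.

Lemma powR_trunc_moment (s : R) : 0 < s ->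
  (s ^+ 2) `^ (1 - eps / 2) = s ^+ 2 / s `^ eps.
Proof.
move=> s0; rewrite powRD; last by apply/implyP => _; rewrite gt_eqF // exprn_gt0.
rewrite powRr1 ?sqr_ge0 // -powR_mulrn ?(ltW s0) // -powRrM -powRN.
by congr (_ * _ `^ _); field.
Qed.

Lemma powR_window_count (s A : R) : 0 < s -> 0 < A ->
  s ^+ 2 * ((A * s / xmin) `^ (1 - beta) - (2 * (A * s) / xmin) `^ (1 - beta))
  = (A / xmin) `^ (- (1 + eps)) * (1 - 2 `^ (- (1 + eps))) * s `^ (1 - eps).
Proof.
move=> s0 A0; have x0 := xmin0; have -> : 1 - beta = - (1 + eps) by ring.
have -> : A * s / xmin = (A / xmin) * s by ring.
have -> : 2 * (A * s) / xmin = 2 * ((A / xmin) * s) by ring.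
rewrite [(2 * _) `^ _]powRM ?mulr_ge0 ?invr_ge0 ?ltW //.
rewrite powRM ?mulr_ge0 ?invr_ge0 ?ltW //.
have -> : s `^ (1 - eps) = s ^+ 2 * s `^ (- (1 + eps)).
  rewrite -powR_mulrn ?(ltW s0) // -powRD; last by apply/implyP => _; rewrite gt_eqF.
  by congr (_ `^ _); ring.
ring.
Qed.

Lemma mean_trunc_id (B nu : R) : xmin <= B -> mean (fun t => t `^ 1) nu ->
  exists2 mq, mean (trunc_id B) mq & mq <= nu.
Proof.
move=> xB hnu; have e0 := eps0.
have r1 : (1 : R) < beta - 1 by lra.
have h := mean_is_lin 1 (- 1) hnu (mean_is_tail_pow xmin0 beta1 xB r1).
have [mq hq] : exists m, mean (trunc_id B) m.
  by eexists; apply: (eq_mean_is h) => // t _; rewrite /trunc_id mul1r mulN1r.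
exists mq => //; apply: (mean_is_le beta1 hq hnu) => t xt; rewrite /trunc_id gerBl.
by rewrite mulr_ge0 ?powR_ge0.
Qed.

Lemma weight_moments : exists nu mom : R,
  [/\ 0 < nu, 0 <= mom, mean (fun t => t `^ 1) nu &
      mean (fun t => t `^ (1 + eps / 2)) mom].
Proof.
have e0 := eps0; have x0 := xmin0; have one := mean_is1 xmin0 beta1.
have [nu hnu] : exists v, mean (fun t => t `^ 1) v.
  by apply: mean_is_pow => //; lra.
have [mom hmom] : exists v, mean (fun t => t `^ (1 + eps / 2)) v.
  by apply: mean_is_pow => //; lra.
exists nu, mom; split => //.
  apply: (lt_le_trans xmin0).
  have := mean_is_le beta1 (mean_is_lin xmin 0 one one) hnu.
  rewrite mulr1 mul0r addr0; apply=> t xt.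
  by rewrite powRr1 ?mulr1 ?mul0r ?addr0 //; lra.
have := mean_is_le beta1 (mean_is_lin 0 0 one one) hmom.
by rewrite !mul0r addr0; apply=> t xt; rewrite ?mul0r ?addr0 powR_ge0.
Qed.

(** [F] is at most [delta] plus the cost of [bad_weights_cost], and [wint_quadratic] evaluates the
    integral of this bound. The last three error terms come from weights over the cap, the volume
    and the window count. *)
Lemma wint_bad_weights (nu mom A : R) (n : nat) (s : R) :
  0 < nu -> 0 <= mom -> 0 < A ->
  mean (fun t => t `^ 1) nu -> mean (fun t => t `^ (1 + eps / 2)) mom ->
  0 < s -> n%:R = s ^+ 2 -> 8 * nu <= s ^+ 2 -> xmin <= A * s ->
  forall (tau delta : R) (F : seq R -> R),
    2 * tau = (A / xmin) `^ (- (1 + eps)) * (1 - 2 `^ (- (1 + eps))) ->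
    0 < tau -> 0 <= delta ->
    (forall t, size t = n -> all (<=%R xmin) t -> 0 <= F t <= 1) ->
    (forall t, size t = n -> good_weights xmin (2 * nu) A tau (s `^ (1 - eps)) s
       (fun i : 'I_n => nth 0 t i) -> F t <= delta) ->
    (wint xmin beta n (fun t => (F t)%:E) <= (delta
       + (4 * (2 * nu)) `^ (1 + eps) / (s `^ eps) ^+ 2
       + (xmin / (4 * (2 * nu))) `^ (1 - eps / 2) * mom / nu ^+ 2 / s `^ eps
       + 2 / (tau * s `^ (1 - eps)))%:E)%E.
Proof.
move=> nu0 mom0 A0 hnu hmom s0 nE hs xAs tau delta F tauE tau0 delta0 F01 Fgood.
have x0 := xmin0; have nR0 : 0 < n%:R :> R by rewrite nE exprn_gt0.
have n0 : (0 < n)%N by rewrite -(ltr0n R).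
have K0 : 0 < 2 * nu by rewrite mulr_gt0.
set B := xmin / (4 * (2 * nu)) * s ^+ 2.
have xB : xmin <= B.
  rewrite /B -mulrA ler_pMr // mulrC ler_pdivlMr ?mulr_gt0 // mul1r; lra.
have As0 : 0 < A * s by exact: mulr_gt0.
have hB := mean_is_tail xmin0 beta1 xB.
have [mq hq mqnu] := mean_trunc_id xB hnu.
have [Q2 hq2 Q2le] := mean_truncated_square xB hmom.
have [hg1 hg12] := mean_is_centered (nu * n%:R)^-1 hq hq2.
have x2As : xmin <= 2 * (A * s) by lra.
have AsAs : A * s <= 2 * (A * s) by lra.
have hA1 := mean_is_tail xmin0 beta1 xAs; have hA2 := mean_is_tail xmin0 beta1 x2As.
have /(eq_mean_is (mean_is_lin 1 (- 1) hA1 hA2)) : forall t, xmin <= t ->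
    1 * (A * s <= t)%R%:R + - 1 * (2 * (A * s) <= t)%R%:R = in_window (A * s) (2 * (A * s)) t.
  by move=> t _; rewrite /in_window; ring.
move=> /(_ _ erefl); set rho := 1 * _ + _ => hrho.
have nrho : n%:R * rho = 2 * tau * s `^ (1 - eps).
  by rewrite tauE -(powR_window_count s0 A0) nE /rho; ring.
have u0 : 0 < s `^ (1 - eps) by exact: powR_gt0.
have v0 : 0 < s `^ eps by exact: powR_gt0.
have rho0 : 0 < rho by rewrite -(pmulr_rgt0 _ nR0) nrho !mulr_gt0.
clearbody rho.
have hrho2 := eq_mean_is hrho (fun t _ => esym (in_window_sqr t AsAs)) erefl.
have [hg2 hg22] := mean_is_centered (2 / (n%:R * rho)) hrho hrho2.
have := wint_quadratic xmin0 beta1 hB hg1 hg12 hg2 hg22 n delta 0 0.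
set G := (fun t : seq R => _) => GE.
apply: (@le_trans _ _ (wint xmin beta n G)); last first.
  rewrite GE lee_fin.
  rewrite expr0n /= !add0r; apply: lerD; first (apply: lerD; first (apply: lerD => //)).
  - by rewrite nE /B powR_tail_count.
  (* The variance is bounded by the second moment, here and for the window, where the indicator
     equals its own square. *)
  - apply: le_trans (_ : n%:R * ((nu * n%:R)^-1 ^+ 2 * (B `^ (1 - eps / 2) * mom)) <= _).
      rewrite ler_pM2l // ler_pM2l ?exprn_gt0 ?invr_gt0 ?mulr_gt0 //.
      by have := sqr_ge0 mq; lra.
    rewrite le_eqVlt; apply/orP; left; apply/eqP.
    rewrite /B powRM ?sqr_ge0 ?divr_ge0 ?mulr_ge0 ?(ltW nu0) ?(ltW xmin0) //.
    by rewrite powR_trunc_moment // nE; field; rewrite !gt_eqF.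
  - apply: le_trans (_ : n%:R * ((2 / (n%:R * rho)) ^+ 2 * rho) <= _).
      rewrite ler_pM2l // ler_pM2l ?exprn_gt0 ?divr_gt0 ?mulr_gt0 //.
      by have := sqr_ge0 rho; lra.
    have -> : n%:R * ((2 / (n%:R * rho)) ^+ 2 * rho) = 4 / (n%:R * rho).
      by field; rewrite !gt_eqF.
    by rewrite nrho le_eqVlt; apply/orP; left; apply/eqP; field; rewrite !gt_eqF.
apply: (le_wint beta1) => t tn tx; have /andP[Ft0 Ft1] := F01 t tn tx.
rewrite /G !lee_fin; split => //; rewrite !add0r.
have [good|bad] := pselect [/\ forall i : 'I_n, nth 0 t i <= B,
        \sum_(i < n) nth 0 t i <= 2 * nu * n%:R &
        n%:R * rho / 2 <= #|[set i : 'I_n | A * s <= nth 0 t i <= 2 * (A * s)]|%:R].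
  have [g1 g2 g3] := good.
  apply: le_trans (_ : delta <= _).
    apply: Fgood => //; split => //.
    - by move=> i; move/allP: tx; apply; rewrite mem_nth // tn.
    - by move=> i; rewrite nE.
    - have -> : tau * s `^ (1 - eps) = n%:R * rho / 2 by rewrite nrho; field.
      by rewrite -(mulrA 2 A s).
  by rewrite -!addrA lerDl !addr_ge0 ?sqr_ge0 // sumr_ge0.
apply: le_trans Ft1 _.
have := bad_weights_cost tn n0 tx nu0 mqnu rho0 AsAs bad.
by move: delta0; clear; lra.
Qed.

Lemma weights_concentrate : exists K A tau : R,
  [/\ 0 < K, 0 < A, 0 < tau & 8 * A ^+ 2 <= xmin] /\
  forall delta : R, 0 < delta -> exists M : R, 1 <= M /\
  forall (n : nat) (s : R), 0 < s -> n%:R = s ^+ 2 ->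
    M <= s `^ (1 - eps) -> M <= s `^ eps ->
  forall F : seq R -> R,
    (forall t, size t = n -> all (<=%R xmin) t -> 0 <= F t <= 1) ->
    (forall t, size t = n -> good_weights xmin K A tau (s `^ (1 - eps)) s
       (fun i : 'I_n => nth 0 t i) -> F t <= delta / 2) ->
    (wint xmin beta n (fun t => (F t)%:E) <= delta%:E)%E.
Proof.
have [nu [mom [nu0 mom0 hnu hmom]]] := weight_moments.
have x0 := xmin0; have e0 := eps0.
(* As [A <= 1], [8 * A ^+ 2 <= 8 * A <= xmin]. *)
pose A := Num.min 1 (xmin / 8).
have A0 : 0 < A by rewrite lt_min ltr01 divr_gt0.
have AE : 8 * A ^+ 2 <= xmin.
  have : A <= 1 by rewrite ge_min lexx.
  have : A <= xmin / 8 by rewrite ge_min lexx orbT.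
  by rewrite expr2; nra.
(* Half of the constant in [powR_window_count], so a good vector has at least half the expected
   number of weights in the window. *)
have [tau tauE] : exists tau, tau = (A / xmin) `^ (- (1 + eps)) * (1 - 2 `^ (- (1 + eps))) / 2.
  by eexists.
have tau0 : 0 < tau.
  rewrite tauE divr_gt0 // mulr_gt0 ?powR_gt0 ?divr_gt0 // subr_gt0 powRN.
  rewrite invf_lt1 ?powR_gt0 //.
  have : (1 : R) `^ (1 + eps) < 2 `^ (1 + eps).
    by apply: gt0_ltr_powR; rewrite ?nnegrE ?ler0n ?ltr1n //; lra.
  by rewrite powR1.
exists (2 * nu), A, tau; split; first by split; rewrite ?mulr_gt0.
move=> delta delta0.
have [C1 C1E] : exists C, C = (4 * (2 * nu)) `^ (1 + eps) by eexists.
have [C2 C2E] : exists C, C = (xmin / (4 * (2 * nu))) `^ (1 - eps / 2) * mom / nu ^+ 2.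
  by eexists.
have C10 : 0 <= C1 by rewrite C1E powR_ge0.
have C20 : 0 <= C2 by rewrite C2E !mulr_ge0 ?powR_ge0 ?invr_ge0 ?sqr_ge0.
(* The first three thresholds make each error term at most [delta / 6], which together with the
   [delta / 2] of good vectors gives [delta]. *)
pose t1 := 6 * C1 / delta; pose t2 := 6 * C2 / delta; pose t3 := 12 / (tau * delta).
pose t4 := xmin / A.
have P1 : 0 <= t1 by rewrite /t1 divr_ge0 ?mulr_ge0 ?(ltW delta0).
have P2 : 0 <= t2 by rewrite /t2 divr_ge0 ?mulr_ge0 ?(ltW delta0).
have P3 : 0 < t3 by rewrite /t3 divr_gt0 ?mulr_gt0.
have P4 : 0 < t4 by rewrite /t4 divr_gt0.
exists (1 + t1 + t2 + t3 + 8 * nu + t4); split; first lra.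
move=> n s s0 nE Mu Mv F F01 Fgood.
have sE : s = s `^ (1 - eps) * s `^ eps.
  rewrite -powRD ?subrK ?powRr1 ?(ltW s0) //.
  by apply/implyP => _; rewrite gt_eqF.
have sM : 1 + 8 * nu + t4 <= s.
  rewrite [leRHS]sE; set u := s `^ (1 - eps) in Mu *; set v := s `^ eps in Mv *.
  have u1 : 1 <= u by lra.
  have uv : 0 <= (u - 1) * v by rewrite mulr_ge0; lra.
  rewrite mulrBl mul1r in uv; lra.
have xAs : xmin <= A * s.
  have : t4 <= s by lra.
  by rewrite /t4 ler_pdivrMr // mulrC.
have hs : 8 * nu <= s ^+ 2.
  have : s <= s ^+ 2 by rewrite expr2 ler_peMr ?(ltW s0) //; lra.
  by lra.
have tE : 2 * tau = (A / xmin) `^ (- (1 + eps)) * (1 - 2 `^ (- (1 + eps))).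
  by rewrite tauE mulrC divfK // pnatr_eq0.
have d2 : 0 <= delta / 2 by lra.
apply: le_trans (wint_bad_weights nu0 mom0 A0 hnu hmom s0 nE hs xAs tE tau0 d2 F01 Fgood) _.
rewrite -C1E -C2E lee_fin.
move: (s `^ (1 - eps)) (s `^ eps) Mu Mv => u v Mu Mv.
have [u1 v1] : 1 <= u /\ 1 <= v by split; lra.
have F1 : C1 / v ^+ 2 <= delta / 6.
  apply: le_trans (_ : C1 / v <= _).
    rewrite ler_wpM2l // lef_pV2 ?posrE ?exprn_gt0 //; try lra.
    by rewrite expr2 ler_peMr //; lra.
  rewrite ler_pdivrMr; last lra.
  have : t1 <= v by lra.
  by rewrite /t1 ler_pdivrMr //; lra.
have F2 : C2 / v <= delta / 6.
  rewrite ler_pdivrMr; last lra.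
  have : t2 <= v by lra.
  by rewrite /t2 ler_pdivrMr //; lra.
have F3 : 2 / (tau * u) <= delta / 6.
  rewrite ler_pdivrMr ?mulr_gt0 //; last lra.
  have : t3 <= u by lra.
  by rewrite /t3 ler_pdivrMr ?mulr_gt0 //; lra.
lra.
Qed.

End WeightConcentration.

(** * From fixed weights to the random power law graph *)

Local Open Scope classical_set_scope.

Lemma powR_sqrt_large (R : realType) (e M : R) : 0 < e -> 0 <= M ->
  exists N : nat, forall n : nat, (N <= n)%N -> M <= (Num.sqrt n%:R) `^ e.
Proof.
move=> e0 M0; exists (Num.truncn ((M `^ e^-1) ^+ 2)).+1 => n Nn.
have h : M `^ e^-1 <= Num.sqrt n%:R.
  rewrite -[leLHS]ger0_norm ?powR_ge0 // -sqrtr_sqr.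
  apply: ler_wsqrtr; apply: ltW; apply: lt_le_trans (truncnS_gt _) _.
  by rewrite ler_nat.
have -> : M = (M `^ e^-1) `^ e by rewrite -powRrM mulVf ?gt_eqF // powRr1.
by apply: ge0_ler_powR; rewrite ?nnegrE ?powR_ge0 ?sqrtr_ge0 ?(ltW e0).
Qed.

Lemma rpl_probE (R : realType) (xmin beta : R) n (Q : graph n -> Prop) :
  rpl_prob xmin beta Q = wint xmin beta n (fun t =>
    (bprob (epr (fun i : 'I_n => nth 0 t i)) (fun E => `[< Q E >]))%:E).
Proof.
rewrite /rpl_prob; congr wint; apply/funext => t; congr EFin.
by apply: eq_bigr => E _; exact: graph_probE.
Qed.

Theorem theorem6p4 (R : realType) (xmin eps nu : R) :
  0 < xmin -> 0 < eps -> eps < 1 / 2 ->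
  (\int[@lebesgue_measure R]_(t in `[xmin, +oo[) (t * plf xmin (2 + eps) t)%:E)%E
    = nu%:E ->
  1 < nu ->
  exists c : R, 0 < c /\
  (forall D : nat -> seq bool -> seq bool -> option nat,
     forall delta : R, 0 < delta -> exists N : nat, forall n : nat, (N <= n)%N ->
       (rpl_prob xmin (2 + eps) (fun E : graph n =>
          exists L : 'I_n -> seq bool,
            (forall x y : 'I_n, D n (L x) (L y) = gdist E x y) /\
            ((\sum_(v < n) size (L v))%:R < c * n%:R `^ (3 / 2 - eps))%R)
        <= delta%:E)%E) /\
  (forall delta : R, 0 < delta -> exists N : nat, forall n : nat, (N <= n)%N ->
       (rpl_prob xmin (2 + eps) (fun E : graph n =>
          exists L : 'I_n -> {set 'I_n},
            two_hop_cover E L /\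
            ((\sum_(v < n) #|L v|)%:R < c * n%:R `^ (3 / 2 - eps))%R)
        <= delta%:E)%E).
Proof.
move=> xmin0 eps0 eps12 _ _.
have eps1 : eps < 1 by lra.
have [K [A [tau [[K0 A0 tau0 AE] conc]]]] := weights_concentrate xmin0 eps0 eps1.
have [c [c0 bound]] := good_weights_bound xmin0 K0 A0 tau0 AE.
exists c; split => //.
(* Stated for any event [Q] controlled by the two conclusions of [good_weights_bound], so that
   labelings and covers share one argument. The threshold [N] is fixed before the decoder enters. *)
have key (delta : R) : 0 < delta -> exists N : nat, forall n : nat, (N <= n)%N ->
    exists u v : R, n%:R `^ (3 / 2 - eps) = u * v * u ^+ 2 /\
    forall Q : graph n -> Prop,
    (forall w : 'I_n -> R, (forall (D : seq bool -> seq bool -> option nat),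
        bprob (epr w) (fun E => `[< exists L : 'I_n -> seq bool,
         (forall x y, D (L x) (L y) = gdist E x y) /\
          (\sum_v size (L v))%:R < c * (u * v * u ^+ 2) >]) <= delta / 2) ->
      bprob (epr w) (fun E => `[< exists L : 'I_n -> {set 'I_n},
        two_hop_cover E L /\ (\sum_v #|L v|)%:R < c * (u * v * u ^+ 2) >]) <= delta / 2 ->
      bprob (epr w) (fun E => `[< Q E >]) <= delta / 2) ->
    (rpl_prob xmin (2 + eps) Q <= delta%:E)%E.
  move=> delta0; have [M1 [M11 conc1]] := conc _ delta0.
  have delta20 : 0 < delta / 2 by rewrite divr_gt0.
  have [M2 [M21 bound2]] := bound _ delta20.
  have eps10 : 0 < 1 - eps by lra.
  have M0 : 0 <= M1 + M2 by lra.
  have [N1 hN1] := powR_sqrt_large eps10 M0.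
  have [N2 hN2] := powR_sqrt_large eps0 M0.
  exists (4 + N1 + N2)%N => n Nn.
  have [n3 nN1 nN2] : [/\ (3 < n)%N, (N1 <= n)%N & (N2 <= n)%N].
    by move: Nn; clear; split; lia.
  set s : R := Num.sqrt n%:R.
  have s0 : 0 < s by rewrite sqrtr_gt0 ltr0n; exact: leq_trans n3.
  have nE : n%:R = s ^+ 2 by rewrite sqr_sqrtr.
  have Mu : M1 + M2 <= s `^ (1 - eps) by exact: hN1.
  have Mv : M1 + M2 <= s `^ eps by exact: hN2.
  have sD a b : s `^ a * s `^ b = s `^ (a + b).
    by rewrite powRD //; apply/implyP => _; rewrite gt_eqF.
  have sE : s `^ (1 - eps) * s `^ eps = s by rewrite sD subrK powRr1 // ltW.
  (* With [n = s ^+ 2], both sides are the power of [s] with exponent [3 - 2 * eps]. *)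
  exists (s `^ (1 - eps)), (s `^ eps); split.
    rewrite sE nE -!powR_mulrn ?powR_ge0 ?(ltW s0) // -!powRrM.
    rewrite -[X in _ = X * _](powRr1 (ltW s0)) sD; congr (_ `^ _).
    by field.
  move=> Q hQ; rewrite rpl_probE.
  apply: (conc1 n s s0 nE); [lra|lra| |].
    move=> t tn tx.
    have wmin (i : 'I_n) : xmin <= nth 0 t i.
      by move/allP: tx; apply; rewrite mem_nth // tn.
    have p01 := epr01 n3 xmin0 wmin.
    rewrite bprob_ge0 //= -(bprob_total (epr (fun i : 'I_n => nth 0 t i))).
    exact: le_bprob.
  move=> t tn good.
  have M2u : M2 <= s `^ (1 - eps) by lra.
  have M2v : M2 <= s `^ eps by lra.
  have [||h1 h2] := bound2 n _ _ (fun i : 'I_n => nth 0 t i) M2u M2v.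
  - by rewrite sE.
  - by rewrite sE.
  exact: hQ.
split=> [D|] delta /key[N hN]; exists N => n /hN[u [v [-> h]]]; apply: h => w h1 h2 //.
Qed.
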